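(* Let $\Omega\subset\mathbb{X}$ be convex and compact, $\kappa$ a positive integer, $\mathcal{F}=\{X\in\Omega:\mathrm{rank}(X)\le\kappa\}\ne\emptyset$, and $\mathcal{F}^*$ the set of global minimizers of $f$ over $\mathcal{F}$. Suppose that the multifunction $\Gamma(\omega)=\{X\in\Omega:\sum_{i=\kappa+1}^n\sigma_i(X)=\omega\}$, $\omega\in\mathbb{R}$, is calm at $0$ for each $X\in\Gamma(0)$, and that $f:\mathbb{X}\to\mathbb{R}$ is a smooth convex function such that $$\vartheta:=\inf_{X\in\mathcal{F},\,Y\in\mathcal{F}^*,\,X\ne Y}\frac{f(X)-f(Y)-\langle\nabla f(Y),X-Y\rangle}{\|X-Y\|_F^2}>0.$$ Then there exists a constant $c>0$ such that for any $X\in\mathbb{X}$, $$\mathrm{dist}(X,\mathcal{F}^* )\le(1+c\sqrt{n})\,\mathrm{dist}(X,\Omega)+c\sum_{i=\kappa+1}^n\sigma_i(X)+\frac{1}{\vartheta}\|\nabla f(\Pi_{\mathcal{F}}(X))-\nabla f(X^* )\|_F,$$ where $X^*$ is an arbitrary point of $\mathcal{F}^*$. Moreover, the constant $c$ can be specified as follows: (i) $c=\sqrt{1+c_u^2/c_l^2}$ when $\mathcal{F}=\{X\in\mathbb{R}^{n_1\times n_2}:\mathrm{rank}(X)\le\kappa,\ |\!|\!|X|\!|\!|\le\gamma\}$ (with $\Omega=\{X\in\mathbb{R}^{n_1\times n_2}:|\!|\!|X|\!|\!|\le\gamma\}$); (ii) $c=\sqrt{2}$ when $\mathcal{F}=\{X\in\mathbb{H}^n_+:\mathrm{rank}(X)\le\kappa,\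 \mathrm{tr}(X)=1\}$ (with $\Omega=\{X\in\mathbb{H}^n_+:\mathrm{tr}(X)=1\}$); (iii) $c=1+2n$ when $\mathcal{F}=\{X\in\mathbb{H}^n_+:\mathrm{rank}(X)\le\kappa,\ \mathrm{diag}(X)=e\}$ (with $\Omega=\{X\in\mathbb{H}^n_+:\mathrm{diag}(X)=e\}$).
   Context: $\mathbb{X}$ denotes either $\mathbb{R}^{n_1\times n_2}$ (with $n=\min(n_1,n_2)$) or the space $\mathbb{H}^n$ of $n\times n$ Hermitian matrices, endowed with the trace inner product $\langle\cdot,\cdot\rangle$ and its induced Frobenius norm $\|\cdot\|_F$; $\mathrm{dist}$ is the distance in $\|\cdot\|_F$. $\mathbb{H}^n_+$ is the cone of Hermitian positive semidefinite matrices. $\sigma_1(X)\ge\cdots\ge\sigma_n(X)\ge0$ are the singular values of $X$; empty sums are $0$. $\Pi_{\mathcal{F}}(X)$ denotes a projection point of $X$ onto the closed set $\mathcal{F}$; in this statement it is the point $\Pi_{\mathcal{F}}(X)$ nearest to $X$ in $\|\cdot\|_F$ (any choice). In (i), $|\!|\!|\cdot|\!|\!|$ is a norm on $\mathbb{R}^{n_1\times n_2}$, $\gamma>0$, and $c_l,c_u>0$ are constants with $c_l\|\cdot\|_F\le|\!|\!|\cdot|\!|\!|\le c_u\|\cdot\|_F$. In (iii), $e\in\mathbb{R}^n$ is the all-ones vector and $\mathrm{diag}(X)$ is the vector of diagonal entries of $X$. Calmness: a multifunction $\Upsilon:\mathbb{Y}\rightrightarrows\mathbb{Z}$ between finite dimensional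 normed spaces is calm at $\overline{y}$ for $\overline{z}\in\Upsilon(\overline{y})$ if there exist $\alpha\ge0$ and neighborhoods $\mathcal{U}$ of $\overline{y}$, $\mathcal{V}$ of $\overline{z}$ such that $\Upsilon(y)\cap\mathcal{V}\subseteq\Upsilon(\overline{y})+\alpha\|y-\overline{y}\|\mathbb{B}_{\mathbb{Z}}$ for all $y\in\mathcal{U}$, where $\mathbb{B}_{\mathbb{Z}}$ is the closed unit ball of $\mathbb{Z}$ centered at the origin. *)

(* Defs.v *)
From HB Require Import structures.
From mathcomp Require Import all_boot all_order all_algebra.
From mathcomp Require Import complex.
From mathcomp Require Import all_classical all_reals all_analysis.
From mathcomp Require Import ring lra.

Set Implicit Arguments.
Unset Strict Implicit.
Unset Printing Implicit Defensive.

Import Order.TTheory GRing.Theory Num.Theory.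
Import numFieldNormedType.Exports.

Local Open Scope classical_set_scope.
Local Open Scope ring_scope.
Local Open Scope sesquilinear_scope.
Local Open Scope complex_scope.

Section Hermitian.
Variables (R : realType) (n : nat).

Definition hermitian : Type := hermitian_matrix n false (@Num.Def.conjC R[i]).

Definition is_hermitian : {pred 'M[R[i]]_n} := fun A => A \is hermsymmx.

HB.instance Definition _ :=
  @isSub.Build _ is_hermitian hermitian (@mx_of_hermitian _ n false (@Num.Def.conjC R[i]))
    (fun A HA => HermitianMx HA) (fun K f u => let: HermitianMx A HA := u in f A HA)
    (fun A HA => erefl).
HB.instance Definition _ := [Choice of hermitian by <:].

Lemma is_hermitianE A : (A \in is_hermitian) = (A == A^t*).
Proof. by rewrite -[A \in _]/(A \is hermsymmx) qualifE expr0 scale1r. Qed.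

Fact is_hermitian_zmod_closed : zmod_closed is_hermitian.
Proof.
split=> [|A B]; rewrite !is_hermitianE ?trmx0 ?map_mx0 //.
by move=> /eqP {1}-> /eqP {1}->; rewrite -map_mxB -raddfB.
Qed.
HB.instance Definition _ :=
  GRing.isZmodClosed.Build _ is_hermitian is_hermitian_zmod_closed.
HB.instance Definition _ := [SubChoice_isSubZmodule of hermitian by <:].

Fact is_hermitian_scale (a : R) (A : hermitian) :
  a%:C *: val A \in is_hermitian.
Proof.
have /eqP hA : val A == (val A)^t* by rewrite -is_hermitianE; exact: valP.
rewrite is_hermitianE linearZ [X in _ == X]map_mxZ -hA; apply/eqP.
by congr (_ *: _); exact/esym/conjc_real.
Qed.
(* Hermitian matrices form a module over the reals only. *)
Definition hermitian_scale (a : R) (A : hermitian) : hermitian :=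
  Sub (a%:C *: val A) (is_hermitian_scale a A).

Fact hermitian_scaleA a b A :
  hermitian_scale a (hermitian_scale b A) = hermitian_scale (a * b) A.
Proof. by apply/val_inj; rewrite /= scalerA rmorphM. Qed.
Fact hermitian_scale1 : left_id 1 hermitian_scale.
Proof. by move=> A; apply/val_inj; rewrite /= rmorph1 scale1r. Qed.
Fact hermitian_scaleDr : right_distributive hermitian_scale +%R.
Proof.
by move=> a A B; apply/val_inj; rewrite /= scalerDr.
Qed.
Fact hermitian_scaleDl A : {morph hermitian_scale^~ A : a b / a + b}.
Proof.
by move=> a b; apply/val_inj; rewrite /= rmorphD scalerDl.
Qed.
HB.instance Definition _ := GRing.Zmodule_isLmodule.Build R hermitian
  hermitian_scaleA hermitian_scale1 hermitian_scaleDr hermitian_scaleDl.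

End Hermitian.

Variant mxspace := RealMx of nat & nat | HermMx of nat.

Section MatrixSpace.
Variables (R : realType) (s : mxspace).

Definition nrows := match s with RealMx n1 _ => n1 | HermMx n => n end.
Definition ncols := match s with RealMx _ n2 => n2 | HermMx n => n end.
Definition mindim := minn nrows ncols.

Definition mat_lmod : lmodType R :=
  match s with RealMx n1 n2 => 'M[R]_(n1, n2) | HermMx n => hermitian R n end.
(* A separate type, since the library already norms 'M[R]_(n1, n2) by the
   maximum of the entries; [mat] is normed below by the Frobenius norm. *)
Definition mat : Type := mat_lmod.
HB.instance Definition _ := GRing.Lmodule.copy mat mat_lmod.

End MatrixSpace.

(* Real and Hermitian matrices are both read as complex matrices, so that the
   inner product, the rank and the singular values are each defined once. For
   real X and Y, [inner X Y] is tr(X^T Y), and map_mx preserves the rank. *)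
Definition cmx (R : realType) (s : mxspace) :
    mat R s -> 'M[R[i]]_(nrows s, ncols s) :=
  match s with
  | RealMx n1 n2 => fun X : 'M[R]_(n1, n2) => map_mx (real_complex R) X
  | HermMx n => fun X : hermitian R n => mx_of_hermitian X
  end.

Definition hmx (R : realType) (n : nat) (X : mat R (HermMx n)) : 'M[R[i]]_n :=
  cmx X.

Section Frobenius.
Variables (R : realType) (s : mxspace).
Implicit Types (X Y Z : mat R s) (a : R).

Definition inner X Y : R := complex.Re (\tr ((cmx X)^t* *m cmx Y)).

Definition frobenius X : R := Num.sqrt (inner X X).

Lemma cmxD X Y : cmx (X + Y) = cmx X + cmx Y.
Proof. by case: s X Y => [n1 n2|n] X Y //=; exact: map_mxD. Qed.

Lemma cmxZ a X : cmx (a *: X) = a%:C *: cmx X.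
Proof. by case: s X => [n1 n2|n] X //=; exact: map_mxZ. Qed.

Lemma cmx_inj : injective (@cmx R s).
Proof.
case: s => [n1 n2|n] X Y //=; last exact: val_inj.
by move/map_mx_inj.
Qed.

Lemma innerE X Y : inner X Y = \sum_j \sum_i
  (complex.Re (cmx X i j) * complex.Re (cmx Y i j) +
   complex.Im (cmx X i j) * complex.Im (cmx Y i j)).
Proof.
rewrite /inner /mxtrace raddf_sum; apply: eq_bigr => j _.
rewrite mxE raddf_sum; apply: eq_bigr => i _; rewrite !mxE.
by case: (cmx X i j) (cmx Y i j) => [a b] [c d] /=; rewrite mulNr opprK.
Qed.

Lemma innerC X Y : inner X Y = inner Y X.
Proof.
rewrite !innerE; apply: eq_bigr => j _; apply: eq_bigr => i _.
by rewrite mulrC [X in _ + X]mulrC.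
Qed.

Lemma innerDl X Y Z : inner (X + Y) Z = inner X Z + inner Y Z.
Proof.
rewrite !innerE -big_split; apply: eq_bigr => j _.
rewrite -big_split; apply: eq_bigr => i _; rewrite cmxD mxE.
by case: (cmx X i j) (cmx Y i j) (cmx Z i j) => [a b] [c d] [e f] /=; ring.
Qed.

Lemma innerZl a X Y : inner (a *: X) Y = a * inner X Y.
Proof.
rewrite !innerE mulr_sumr; apply: eq_bigr => j _.
rewrite mulr_sumr; apply: eq_bigr => i _.
rewrite cmxZ !mxE; case: (cmx X i j) (cmx Y i j) => [b c] [d e] /=; ring.
Qed.

Lemma innerDr X Y Z : inner Z (X + Y) = inner Z X + inner Z Y.
Proof. by rewrite innerC innerDl ![inner _ Z]innerC. Qed.

Lemma innerZr a X Y : inner Y (a *: X) = a * inner Y X.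
Proof. by rewrite innerC innerZl innerC. Qed.

Lemma inner_ge0 X : 0 <= inner X X.
Proof.
by rewrite innerE; do 2!apply: sumr_ge0 => ? _; rewrite -!expr2 addr_ge0 ?sqr_ge0.
Qed.

Lemma inner_eq0 X : inner X X = 0 -> X = 0.
Proof.
rewrite innerE => X0; apply: cmx_inj; apply/matrixP => i j.
have ge0 (k : 'I_(ncols s)) (l : 'I_(nrows s)) : 0 <=
    complex.Re (cmx X l k) * complex.Re (cmx X l k) +
    complex.Im (cmx X l k) * complex.Im (cmx X l k).
  by rewrite -!expr2 addr_ge0 ?sqr_ge0.
have /psumr_eq0P X0j := X0.
have /psumr_eq0P := X0j (fun k _ => sumr_ge0 _ (fun l _ => ge0 k l)) j isT.
move=> /(_ (fun l _ => ge0 j l) i isT)/eqP.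
rewrite -!expr2 paddr_eq0 ?sqr_ge0 // !sqrf_eq0.
rewrite -[0 : mat R s](scale0r 0) cmxZ scale0r mxE.
by case: (cmx X i j) => [a b] /= /andP[/eqP-> /eqP->].
Qed.

Lemma inner_CauchySchwarz X Y : inner X Y <= frobenius X * frobenius Y.
Proof.
have [/eqP Y0|Y0] := boolP (inner Y Y == 0).
  by rewrite (inner_eq0 Y0) -[0 : mat R s](scale0r 0) innerZr mul0r
    mulr_ge0 ?sqrtr_ge0.
have Ygt0 : 0 < inner Y Y by rewrite lt_neqAle eq_sym Y0 inner_ge0.
rewrite -sqrtrM ?inner_ge0 //; apply: le_trans (ler_norm _) _.
rewrite -sqrtr_sqr ler_sqrt ?mulr_ge0 ?inner_ge0 //.
have := inner_ge0 (inner Y Y *: X - inner X Y *: Y).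
rewrite -scaleN1r innerDl !innerDr !innerZl !innerZr [inner Y X]innerC.
set a := inner X X; set b := inner Y Y; set c := inner X Y.
move=> h; rewrite -subr_ge0 -(pmulr_rge0 _ Ygt0) -/b; apply: le_trans h _.
by rewrite le_eqVlt; apply/orP; left; apply/eqP; ring.
Qed.

Lemma frobeniusD X Y : frobenius (X + Y) <= frobenius X + frobenius Y.
Proof.
rewrite -(@ler_pXn2r _ 2) ?nnegrE ?addr_ge0 ?sqrtr_ge0 //.
rewrite sqrrD !sqr_sqrtr ?inner_ge0 // innerDl !innerDr [inner Y X]innerC.
have := inner_CauchySchwarz X Y; lra.
Qed.

Lemma frobeniusZ a X : frobenius (a *: X) = `|a| * frobenius X.
Proof.
by rewrite /frobenius innerZl innerZr mulrA -expr2 sqrtrM ?sqr_ge0 // sqrtr_sqr.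
Qed.

Lemma frobenius_eq0 X : frobenius X = 0 -> X = 0.
Proof.
move/eqP; rewrite sqrtr_eq0 => X0; apply: inner_eq0.
by apply/eqP; rewrite eq_le X0 inner_ge0.
Qed.

HB.instance Definition _ := Lmodule_isNormed.Build R (mat R s)
  frobeniusD frobeniusZ frobenius_eq0.

Lemma mat_normE X : `|X| = frobenius X.
Proof. by []. Qed.

End Frobenius.

Section Rank.
Variables (R : realType) (s : mxspace).

(* The nonincreasing sequence of the square roots of the n eigenvalues of
   A^* A; all entries of index >= minn m n are 0. The indexing starts at 0: the
   entry of index i is \sigma_(i+1). *)
Definition singular_values (m n : nat) (A : 'M[R[i]]_(m, n)) : seq R :=
  sort >=%R [seq Num.sqrt (complex.Re (spectral_diag (A^t* *m A) 0 j)) | j : 'I_n].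

(* \sigma_(kappa+1)(X) + ... + \sigma_n(X) *)
Definition tail_sum (kappa : nat) (X : mat R s) : R :=
  \sum_(kappa <= i < mindim s) (singular_values (cmx X))`_i.

Definition low_rank (Omega : set (mat R s)) (kappa : nat) : set (mat R s) :=
  [set X | Omega X /\ (\rank (cmx X) <= kappa)%N].

Definition tail_level (Omega : set (mat R s)) (kappa : nat) (w : R^o) :
    set (mat R s) :=
  [set X | Omega X /\ tail_sum kappa X = w].

End Rank.

Section Variational.
Variable R : realType.

Definition calm (Y Z : normedModType R) (Ups : Y -> set Z) (y0 : Y) (z0 : Z) :=
  exists alpha : R, 0 <= alpha /\
  exists U V, [/\ nbhs y0 U, nbhs z0 V &
    forall y, U y -> Ups y `&` V `<=`
      [set z + (alpha * `|y - y0|) *: b | z in Ups y0 & b in [set b | `|b| <= 1]]].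

Definition dist (V : normedModType R) (x : V) (A : set V) : R :=
  inf [set `|x - y| | y in A].

Definition nearest_point (V : normedModType R) (A : set V) (x p : V) :=
  A p /\ forall y, A y -> `|x - p| <= `|x - y|.

Definition minimizers (T : Type) (f : T -> R) (A : set T) : set T :=
  [set x | A x /\ forall y, A y -> f x <= f y].

Definition is_norm (V : lmodType R) (N : V -> R) :=
  [/\ forall x y, N (x + y) <= N x + N y,
      forall a x, N (a *: x) = `|a| * N x &
      forall x, N x = 0 -> x = 0].

(* On R[i], 0 <= z means that z is real and nonnegative. *)
Definition psd (n : nat) (A : 'M[R[i]]_n) :=
  forall v : 'cV[R[i]]_n, 0 <= (v^t* *m A *m v) 0 0.

End Variational.

Section ErrorBound.
Variables (R : realType) (s : mxspace) (Omega : set (mat R s)) (kappa : nat).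
Variables (f : mat R s -> R^o) (gradf : mat R s -> mat R s).

(* [gradf] is the gradient of [f] for the trace inner product. *)
Definition is_gradient :=
  forall X, differentiable f X /\ forall H, 'd f X H = inner (gradf X) H.

Let F := low_rank Omega kappa.
Let Fstar := minimizers f F.

(* The infimum of the empty set is +oo, and then theta^-1 = 0. *)
Definition theta : \bar R :=
  ereal_inf [set r | exists X Y, [/\ F X, Fstar Y, X <> Y &
    r = ((f X - f Y - inner (gradf Y) (X - Y)) / `|X - Y| ^+ 2)%:E]].

(* [f_smooth] reads smoothness as continuity of the gradient. *)
Record assumptions : Prop := {
  Omega_convex : convex_set Omega;
  Omega_compact : compact Omega;
  kappa_gt0 : (0 < kappa)%N;
  F_nonempty : F !=set0;
  tail_calm : forall X, tail_level Omega kappa 0 X ->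
    calm (tail_level Omega kappa) 0 X;
  f_gradient : is_gradient;
  f_smooth : continuous gradf;
  f_convex : convex_function setT f;
  theta_gt0 : (0 < theta)%E
}.

Definition error_bound (c : R) :=
  forall X P Xstar, nearest_point F X P -> Fstar Xstar ->
  ((dist X Fstar)%:E <=
   ((1 + c * Num.sqrt (mindim s)%:R) * dist X Omega)%:E
   + (c * tail_sum kappa X)%:E
   + theta^-1 * `|gradf P - gradf Xstar|%:E)%E.

End ErrorBound.

(* Main.v *)
Require Import Defs.
From mathcomp Require Import all_boot all_order all_algebra.
From mathcomp Require Import perm complex.
From mathcomp Require Import all_classical all_reals all_analysis.
From mathcomp Require Import ring lra.
Import Order.TTheory GRing.Theory Num.Theory.
Import numFieldNormedType.Exports.
Import ComplexField.Normc.
Local Open Scope classical_set_scope.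
Local Open Scope ring_scope.
Local Open Scope sesquilinear_scope.
Local Open Scope complex_scope.
Set Implicit Arguments.
Unset Strict Implicit.
Unset Printing Implicit Defensive.

(* Write tail for sigma_(kappa+1) + ... + sigma_n. If every Y in Omega is within
   c * tail(Y) of a point of F, then X is within
   (1 + c * sqrt n) * dist(X, Omega) + c * tail(X) of F, since tail is
   sqrt n-Lipschitz by Mirsky's inequality. The distance from the projection P
   of X to a minimizer S is bounded by combining theta * |P - S|^2 <=
   f(P) - f(S) - <grad f(S), P - S> with the convexity of f, which bounds the
   right-hand side by <grad f(P) - grad f(S), P - S>.

   Calmness gives such a c locally, tail is bounded away from 0 near the points
   of Omega outside F, and compactness makes c uniform. In the three special
   cases the point of F is explicit: the truncated singular value decomposition,
   rescaled in (i); the truncated spectral decomposition with the lost trace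
   given to the first eigenvector in (ii); and, in (iii), the Gram matrix of the
   normalized rows of V, where V V^* is the truncated spectral decomposition. *)

(** * A rearrangement inequality *)

(** Abel summation: the weight [a k] is the drop from [s k] to the next value, with [s] continued by
    0 past its last index. So [s] is a nonnegative combination of indicators of initial segments. *)
Lemma nonincreasing_layers (R : realDomainType) (n : nat) (s : 'I_n -> R) :
  (forall i, 0 <= s i) -> (forall i j : 'I_n, (i <= j)%N -> s j <= s i) ->
  exists2 a : 'I_n -> R, (forall k, 0 <= a k) &
    forall i, s i = \sum_k a k * (i <= k)%N%:R.
Proof.
move=> s0 sdec; pose s' (k : nat) : R := oapp s 0 (insub k).
have s'E (i : 'I_n) : s' i = s i by rewrite /s' valK.
have s'n : s' n = 0 by rewrite /s' insubF // ltnn.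
exists (fun k : 'I_n => s' k - s' k.+1) => [k|i].
  rewrite subr_ge0 s'E /s'; case: insubP => [j _ ejk|_] /=; last exact: s0.
  by apply: sdec; rewrite ejk.
have /= := telescope_sumr (fun k => - s' k) (ltnW (ltn_ord i)).
rewrite s'n oppr0 sub0r opprK s'E => <-.
rewrite (big_nat_widenl _ 0) // big_mkord big_mkcond /=.
apply: eq_bigr => k _; rewrite opprK addrC.
by case: leqP; rewrite ?mulr1 ?mulr0.
Qed.

(* The mass of [S] in the corner [i <= k], [j <= l] is at most [min k l + 1],
   its value for the identity matrix. *)
Lemma substochastic_sum_le (R : realDomainType) (n : nat) (s t : 'I_n -> R)
    (S : 'I_n -> 'I_n -> R) :
  (forall i, 0 <= s i) -> (forall i j : 'I_n, (i <= j)%N -> s j <= s i) ->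
  (forall i, 0 <= t i) -> (forall i j : 'I_n, (i <= j)%N -> t j <= t i) ->
  (forall i j, 0 <= S i j) -> (forall i, \sum_j S i j <= 1) ->
  (forall j, \sum_i S i j <= 1) ->
  \sum_i \sum_j s i * t j * S i j <= \sum_i s i * t i.
Proof.
move=> s0 sdec t0 tdec S0 Srow Scol.
have [a a0 sE] := nonincreasing_layers s0 sdec.
have [b b0 tE] := nonincreasing_layers t0 tdec.
(* After both layer decompositions only products of indicators of initial segments remain, that is,
   corners of [S]. *)
have expand (i j : 'I_n) : s i * t j =
    \sum_k \sum_l a k * b l * ((i <= k)%N%:R * (j <= l)%N%:R).
  rewrite sE tE mulr_suml; apply: eq_bigr => k _.
  by rewrite mulr_sumr; apply: eq_bigr => l _; rewrite mulrACA.
have -> : \sum_i \sum_j s i * t j * S i j = \sum_k \sum_l a k * b l *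
    (\sum_(i < n) \sum_(j < n) (i <= k)%N%:R * (j <= l)%N%:R * S i j).
  under eq_bigr do under eq_bigr do (rewrite expand mulr_suml;
    under eq_bigr do rewrite mulr_suml).
  under eq_bigr do rewrite exchange_big.
  rewrite exchange_big; apply: eq_bigr => k _.
  under eq_bigr do rewrite exchange_big.
  rewrite exchange_big; apply: eq_bigr => l _.
  rewrite mulr_sumr; apply: eq_bigr => i _.
  by rewrite mulr_sumr; apply: eq_bigr => j _; rewrite -!mulrA.
have -> : \sum_i s i * t i = \sum_k \sum_l a k * b l *
    (\sum_(i < n) (i <= k)%N%:R * (i <= l)%N%:R).
  under eq_bigr do rewrite expand.
  rewrite exchange_big; apply: eq_bigr => k _.
  rewrite exchange_big; apply: eq_bigr => l _.
  by rewrite mulr_sumr.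
apply: ler_sum => k _; apply: ler_sum => l _.
apply: ler_wpM2l; first exact: mulr_ge0.
(* A corner with at most as many rows as columns is bounded through its row sums, any other through
   its column sums. *)
have [kl|/ltnW lk] := leqP k l.
  apply: ler_sum => i _; have [ik|] := leqP i k; last by
    rewrite !mul0r big1 // => j _; rewrite mul0r mul0r.
  rewrite (leq_trans ik kl) mulr1; apply: le_trans (Srow i).
  by apply: ler_sum => j _; rewrite mul1r; case: (j <= l)%N; rewrite ?mul1r ?mul0r.
rewrite exchange_big; apply: ler_sum => j _; have [jl|] := leqP j l; last by
  rewrite !mulr0 big1 // => i _; rewrite mulr0 mul0r.
rewrite (leq_trans jl lk) mulr1; apply: le_trans (Scol j).
by apply: ler_sum => i _; rewrite mulr1; case: (i <= k)%N; rewrite ?mul1r ?mul0r.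
Qed.

(** * Singular values and the von Neumann trace inequality *)

Lemma char_poly_similar (F : fieldType) (n : nat) (P A : 'M[F]_n) :
  P \in unitmx -> char_poly (invmx P *m A *m P) = char_poly A.
Proof.
move=> Pu; rewrite /char_poly.
have -> : char_poly_mx (invmx P *m A *m P) =
    map_mx polyC (invmx P) *m char_poly_mx A *m map_mx polyC P.
  rewrite /char_poly_mx mulmxBr mulmxBl !map_mxM; congr (_ - _).
  by rewrite scalar_mxC -mulmxA -map_mxM mulVmx // map_mx1 mulmx1.
rewrite !det_mulmx mulrAC -det_mulmx -map_mxM mulVmx // map_mx1 det1 mul1r.
by [].
Qed.

(** Both diagonals list the roots of one characteristic polynomial, which similarity preserves. *)
Lemma unitary_diag_perm (C : numClosedFieldType) (n : nat) (V W : 'M[C]_n)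
    (d e : 'rV[C]_n) :
  V \is unitarymx -> W \is unitarymx ->
  V^t* *m diag_mx d *m V = W^t* *m diag_mx e *m W ->
  perm_eq [seq d 0 j | j : 'I_n] [seq e 0 j | j : 'I_n].
Proof.
move=> Vu Wu.
move/(congr1 (@char_poly _ _)); rewrite -!invmx_unitary //.
rewrite !char_poly_similar ?unitarymx_unit //.
rewrite !char_poly_trig ?diag_mx_is_trig // => de.
apply: prod_XsubC_eq; rewrite !big_image /=.
have E (f : 'rV[C]_n) : \prod_(i < n) ('X - (f 0 i)%:P) =
    \prod_(i < n) ('X - (diag_mx f i i)%:P).
  by apply: eq_bigr => i _; rewrite mxE eqxx.
by rewrite !E.
Qed.

(** * Sorting a spectral decomposition *)

Section RowPerm.
Variables (R : comNzRingType) (n : nat) (p : {perm 'I_n}).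
Implicit Types (U W : 'M[R]_n) (d : 'rV[R]_n).

Lemma diag_mx_row_perm U W d :
  col_perm p U *m diag_mx (col_perm p d) *m row_perm p W = U *m diag_mx d *m W.
Proof.
apply/matrixP => i j; rewrite !mul_mx_diag !mxE.
rewrite [RHS](reindex_inj (@perm_inj _ p)) /=.
by apply: eq_bigr => k _; rewrite !mxE.
Qed.

Lemma row_perm_mul1 U W :
  W *m U = 1%:M -> row_perm p W *m col_perm p U = 1%:M.
Proof.
move=> WU; apply/matrixP => i j.
have := congr1 (fun M : 'M[R]_n => M (p i) (p j)) WU.
rewrite !mxE (inj_eq perm_inj) => <-.
by apply: eq_bigr => k _; rewrite !mxE.
Qed.

End RowPerm.

Lemma ord_sort_perm (R : realDomainType) (n : nat) (d : 'I_n -> R) :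
  exists p : {perm 'I_n}, forall i j : 'I_n, (i <= j)%N -> d (p j) <= d (p i).
Proof.
have : perm_eq (sort (relpre d >=%R) (enum 'I_n)) (ord_tuple n).
  by rewrite perm_sort.
move=> /tuple_permP[p pE]; exists p => i j ij.
have tr : transitive (relpre d >=%R) by move=> x y z /=; exact: ge_trans.
have srt : sorted (relpre d >=%R) (sort (relpre d >=%R) (enum 'I_n)).
  by apply: sort_sorted => x y /=; rewrite le_total.
have nthE (k : 'I_n) : nth i (sort (relpre d >=%R) (enum 'I_n)) k = p k.
  by rewrite pE nth_mktuple tnth_ord_tuple.
move: (ij); rewrite leq_eqVlt => /orP[/eqP/val_inj-> //|lij].
have := sorted_ltn_nth tr i srt; rewrite -!nthE; apply => //;
  by rewrite inE size_sort size_enum_ord.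
Qed.

(** Spectra are kept as real rows, where order and square roots are available; this embeds them as
    complex diagonal matrices. *)
Definition rdiag (R : realType) (n : nat) (d : 'rV[R]_n) : 'M[R[i]]_n :=
  diag_mx (map_mx (real_complex R) d).

Section RealDiagonal.
Variables (R : realType) (n : nat).
Implicit Types d e : 'rV[R]_n.

Lemma rdiagE d i j : rdiag d i j = (d 0 i)%:C *+ (i == j).
Proof. by rewrite !mxE. Qed.

Lemma rdiagM d e : rdiag d *m rdiag e = rdiag (\row_j (d 0 j * e 0 j)).
Proof.
rewrite mulmx_diag; congr diag_mx.
by apply/rowP => j; rewrite !mxE -rmorphM.
Qed.

Lemma rdiag_adj d : (rdiag d)^t* = rdiag d.
Proof.
apply/matrixP => i j; rewrite !mxE eq_sym.
by case: eqP => [->|_]; rewrite ?mulr1n ?mulr0n ?rmorph0 //; exact: conjc_real.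
Qed.

Lemma rdiag1 : rdiag (const_mx 1 : 'rV[R]_n) = 1%:M.
Proof. by apply/matrixP => i j; rewrite !mxE. Qed.

Lemma rdiagB d e : rdiag (d - e) = rdiag d - rdiag e.
Proof. by rewrite /rdiag map_mxB raddfB. Qed.

Lemma rdiag0 : rdiag (0 : 'rV[R]_n) = 0.
Proof. by rewrite /rdiag map_mx0 raddf0. Qed.

Lemma tr_rdiag d : \tr (rdiag d) = (\sum_j d 0 j)%:C.
Proof. by rewrite mxtrace_diag rmorph_sum; apply: eq_bigr => j _; rewrite mxE. Qed.

End RealDiagonal.

(** * Adjoints and Gram matrices *)

Section Adjoint.
Variable R : realType.

Lemma adjM (m n p : nat) (A : 'M[R[i]]_(m, n)) (B : 'M[R[i]]_(n, p)) :
  (A *m B)^t* = B^t* *m A^t*.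
Proof. by rewrite trmx_mul map_mxM. Qed.

Lemma adjB (m n : nat) (A B : 'M[R[i]]_(m, n)) : (A - B)^t* = A^t* - B^t*.
Proof. by rewrite raddfB map_mxB. Qed.

Lemma adj1 (n : nat) : (1%:M : 'M[R[i]]_n)^t* = 1%:M.
Proof. by rewrite trmx1 map_mx1. Qed.

Lemma unitarymxPl (n : nat) (W : 'M[R[i]]_n) :
  W \is unitarymx -> W^t* *m W = 1%:M.
Proof. by rewrite -trmxC_unitary => /unitarymxP; rewrite trmxCK. Qed.

Lemma gram_diagE (m n : nat) (A : 'M[R[i]]_(m, n)) j :
  (A^t* *m A) j j =
  (\sum_i (complex.Re (A i j) ^+ 2 + complex.Im (A i j) ^+ 2))%:C.
Proof.
rewrite mxE rmorph_sum; apply: eq_bigr => i _; rewrite !mxE.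
by rewrite mulrC -normCK -add_Re2_Im2.
Qed.

(** The diagonal of the Gram matrix holds the squared norms of the columns. Several identities below
    are proved by computing the Gram matrix of a difference. *)
Lemma gram_eq0 (m n : nat) (A : 'M[R[i]]_(m, n)) : A^t* *m A = 0 -> A = 0.
Proof.
move=> A0; apply/matrixP => i j; rewrite mxE.
have := gram_diagE A j; rewrite A0 mxE => /esym/complexI/eqP.
rewrite psumr_eq0; last by move=> k _; rewrite addr_ge0 ?sqr_ge0.
move=> /allP/(_ i); rewrite mem_index_enum => /(_ isT) /=.
rewrite paddr_eq0 ?sqr_ge0 // !sqrf_eq0.
by case: (A i j) => a b /= /andP[/eqP-> /eqP->].
Qed.

Lemma gramM (m n p : nat) (A : 'M[R[i]]_(m, n)) (B : 'M[R[i]]_(n, p)) :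
  (A *m B)^t* *m (A *m B) = B^t* *m (A^t* *m A) *m B.
Proof. by rewrite adjM !mulmxA. Qed.

Lemma gram_hermsym (m n : nat) (A : 'M[R[i]]_(m, n)) : A^t* *m A \is hermsymmx.
Proof. by apply/is_hermitianmxP; rewrite expr0 scale1r adjM trmxCK. Qed.

End Adjoint.

(** The matrix factors through a space of dimension [k]. *)
Lemma rank_diag_mx_le (F : fieldType) (n k : nat) (d : 'rV[F]_n) :
  (forall j : 'I_n, (k <= j)%N -> d 0 j = 0) -> (\rank (diag_mx d) <= k)%N.
Proof.
move=> dk; have -> : diag_mx d =
    diag_mx d *m (pid_mx k : 'M[F]_(n, k)) *m (pid_mx k : 'M[F]_(k, n)).
  rewrite -mulmxA mul_pid_mx !minnn mul_diag_mx; apply/matrixP => i j; rewrite !mxE.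
  have [->|ij] := eqVneq i j; last by rewrite (negbTE (ij : i != j :> nat)) mulr0.
  by rewrite eqxx; case: ltnP => [|/dk->]; rewrite ?mulr1 ?mul0r.
exact: mulmx_max_rank.
Qed.

Lemma sorted_row (R : realDomainType) (n : nat) (s : 'rV[R]_n) :
  (forall i j : 'I_n, (i <= j)%N -> s 0 j <= s 0 i) ->
  sorted >=%R [seq s 0 j | j : 'I_n].
Proof.
case: n s => [|k] s sdec.
  have /size0nil-> // : size [seq s 0 j | j : 'I_0] = 0%N.
  by rewrite size_map size_enum_ord.
apply/(sortedP 0) => i; rewrite size_map size_enum_ord => ik.
have iE (l : nat) (lk : (l < k.+1)%N) : [seq s 0 j | j : 'I_k.+1]`_l = s 0 (Ordinal lk).
  rewrite (nth_map ord0) ?size_enum_ord //; congr (s 0 _).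
  by apply: val_inj; rewrite /= nth_enum_ord.
by rewrite (iE _ ik) (iE _ (ltnW ik)); exact: sdec.
Qed.

Lemma row_perm_adj (C : numClosedFieldType) (n : nat) (p : {perm 'I_n})
    (W : 'M[C]_n) : (row_perm p W)^t* = col_perm p (W^t*).
Proof. by rewrite tr_row_perm map_col_perm. Qed.

Lemma row_perm_unitary (C : numClosedFieldType) (n : nat) (p : {perm 'I_n})
    (W : 'M[C]_n) : W \is unitarymx -> row_perm p W \is unitarymx.
Proof.
by move=> /unitarymxP Wu; apply/unitarymxP; rewrite row_perm_adj row_perm_mul1.
Qed.

(** The half of a singular value decomposition that is visible on [A^t* *m A]: the columns of [W^t*]
    are right singular vectors, and [s] has one entry per column of [A], zeros included. The left
    factor is recovered in [right_svd_factor]. *)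
Definition right_svd (R : realType) (m n : nat) (A : 'M[R[i]]_(m, n))
    (W : 'M[R[i]]_n) (s : 'rV[R]_n) : Prop :=
  [/\ W \is unitarymx, A^t* *m A = W^t* *m rdiag (\row_j s 0 j ^+ 2) *m W,
      forall j, 0 <= s 0 j & forall i j : 'I_n, (i <= j)%N -> s 0 j <= s 0 i].

Section RightSVD.
Variables (R : realType) (m n : nat).
Implicit Types (A : 'M[R[i]]_(m, n)) (W : 'M[R[i]]_n) (s : 'rV[R]_n).

Lemma right_svd_gram A W s : right_svd A W s ->
  (A *m W^t*)^t* *m (A *m W^t*) = rdiag (\row_j s 0 j ^+ 2).
Proof.
case=> Wu AA _ _; rewrite gramM trmxCK AA !mulmxA.
by rewrite (unitarymxP Wu) mul1mx -mulmxA (unitarymxP Wu) mulmx1.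
Qed.

Lemma right_svd_exists A : exists W s, right_svd A W s.
Proof.
pose V := spectralmx (A^t* *m A); pose d := spectral_diag (A^t* *m A).
have Vu : V \is unitarymx by exact: spectral_unitarymx.
have AA : A^t* *m A = V^t* *m diag_mx d *m V.
  rewrite -invmx_unitary //.
  exact/orthomx_spectralP/hermitian_normalmx/gram_hermsym.
(* The eigenvalue of index [j] is the squared norm of column [j] of [A *m V^t*], hence real and
   nonnegative. *)
have dE : exists2 e : 'I_n -> R, (forall j, 0 <= e j) & forall j, d 0 j = (e j)%:C.
  exists (fun j => \sum_i (complex.Re ((A *m V^t*) i j) ^+ 2 +
                       complex.Im ((A *m V^t*) i j) ^+ 2)) => j.
    by apply: sumr_ge0 => i _; rewrite addr_ge0 ?sqr_ge0.
  rewrite -gram_diagE gramM trmxCK AA !mulmxA (unitarymxP Vu) mul1mx.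
  by rewrite -mulmxA (unitarymxP Vu) mulmx1 mxE eqxx.
have [e e0 {}dE] := dE.
have [p pP] := ord_sort_perm e.
exists (row_perm p V), (\row_j Num.sqrt (e (p j))); split.
- exact: row_perm_unitary.
- rewrite AA -(diag_mx_row_perm p) row_perm_adj; congr (_ *m _ *m _).
  congr diag_mx; apply/rowP => j; rewrite !mxE dE.
  by rewrite sqr_sqrtr.
- by move=> j; rewrite mxE sqrtr_ge0.
- by move=> i j ij; rewrite !mxE ler_wsqrtr // pP.
Qed.

(** The spectral decomposition behind [singular_values] has its own unitary matrix and its own
    order; the two diagonals agree up to a permutation, which sorting removes. *)
Lemma right_svd_singular_values A W s : right_svd A W s ->
  singular_values A = [seq s 0 j | j : 'I_n].
Proof.
case=> Wu AA s0 sdec.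
have /orthomx_spectralP : A^t* *m A \is normalmx.
  exact/hermitian_normalmx/gram_hermsym.
rewrite {1}AA invmx_unitary ?spectral_unitarymx // => /esym.
move=> /(unitary_diag_perm (spectral_unitarymx _) Wu).
move=> /(perm_map (fun x : R[i] => Num.sqrt (complex.Re x))).
set g := fun x : R[i] => _ => ps.
have E : [seq s 0 j | j : 'I_n] =
    map g [seq (map_mx (real_complex R) (\row_j s 0 j ^+ 2)) 0 j | j : 'I_n].
  rewrite -[RHS](@map_comp _ _ _ g (fun j => map_mx (real_complex R) _ 0 j)).
  by apply: eq_map => j; rewrite /= /g !mxE /= sqrtr_sqr ger0_norm.
transitivity (sort >=%R [seq s 0 j | j : 'I_n]).
  rewrite E -(perm_sortP ge_total ge_trans ge_anti _ _ ps) /singular_values.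
  by rewrite -(map_comp g (fun j => spectral_diag (A^t* *m A) 0 j)).
apply: sorted_sort; first exact: ge_trans.
exact: sorted_row.
Qed.

Lemma nth_singular_values A W s (i : 'I_n) : right_svd A W s ->
  (singular_values A)`_i = s 0 i.
Proof.
move=> /right_svd_singular_values ->.
by rewrite (nth_map i) ?size_enum_ord ?nth_ord_enum.
Qed.

End RightSVD.

(** * The trace inequality, Mirsky's inequality and the rank *)

Section SingularFactor.
Variables (R : realType) (m n : nat).
Implicit Types (A B : 'M[R[i]]_(m, n)) (W : 'M[R[i]]_n) (s : 'rV[R]_n).

(* [P] is the partial isometry of the decomposition [A = P diag(s) W]; its
   columns are [A w_j / s_j], read as 0 when [s_j = 0]. *)
Lemma right_svd_factor A W s : right_svd A W s ->
  exists P : 'M[R[i]]_(m, n), A = P *m rdiag s *m W /\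
    P^t* *m P = rdiag (\row_j (s 0 j != 0)%:R).
Proof.
move=> svdA; have AWE := right_svd_gram svdA; case: svdA => Wu _ _ _.
pose t : 'rV[R]_n := \row_j (s 0 j)^-1.
exists (A *m W^t* *m rdiag t); split; last first.
  rewrite gramM rdiag_adj AWE !rdiagM; congr rdiag; apply/rowP => j; rewrite !mxE.
  have [->|s0] := eqVneq (s 0 j) 0; first by rewrite invr0 !mul0r.
  by rewrite expr2 mulrA mulVf // mul1r mulfV.
pose e : 'rV[R]_n := \row_j (s 0 j != 0)%:R.
have te : rdiag t *m rdiag s = rdiag e.
  rewrite rdiagM; congr rdiag; apply/rowP => j; rewrite !mxE.
  by have [->|s0] := eqVneq (s 0 j) 0; rewrite ?mulr0 // mulVf.
(* The columns of [A *m W^t*] at which [s] vanishes have norm 0. *)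
have AWe : A *m W^t* *m (1%:M - rdiag e) = 0.
  apply: gram_eq0; rewrite gramM AWE -rdiag1 -rdiagB rdiag_adj !rdiagM -[RHS](rdiag0 R).
  congr rdiag; apply/rowP => j; rewrite !mxE.
  have [->|s0] := eqVneq (s 0 j) 0; last by rewrite subrr !mul0r.
  by rewrite expr0n mulr0 mul0r.
rewrite -(mulmxA _ (rdiag t)) te.
move: AWe; rewrite mulmxBr mulmx1 => /eqP; rewrite subr_eq0 => /eqP <-.
by rewrite -mulmxA (unitarymxPl Wu) mulmx1.
Qed.

Lemma right_svd_norm A W s : right_svd A W s ->
  complex.Re (\tr (A^t* *m A)) = \sum_j s 0 j ^+ 2.
Proof.
case=> Wu -> _ _; rewrite -mulmxA mxtrace_mulC -mulmxA (unitarymxP Wu) mulmx1.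
by rewrite tr_rdiag /=; apply: eq_bigr => j _; rewrite mxE.
Qed.

Lemma bessel (k : nat) (P : 'M[R[i]]_(m, n)) (Q : 'M[R[i]]_(m, k)) (s : 'rV[R]_n) j :
  P^t* *m P = rdiag (\row_j (s 0 j != 0)%:R) ->
  complex.Re (((P^t* *m Q)^t* *m (P^t* *m Q)) j j) <= complex.Re ((Q^t* *m Q) j j).
Proof.
move=> PP; set e := (\row_j _) in PP.
have Pe : P *m (1%:M - rdiag e) = 0.
  apply: gram_eq0; rewrite gramM PP -rdiag1 -rdiagB rdiag_adj !rdiagM -[RHS](rdiag0 R).
  congr rdiag; apply/rowP => i; rewrite !mxE.
  by case: eqP; rewrite /= ?subrr ?mul0r ?mulr0 ?mul0r.
have {}Pe : P *m rdiag e = P.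
  by apply/esym/eqP; rewrite -subr_eq0 -{1}(mulmx1 P) -mulmxBr Pe.
rewrite -subr_ge0 -raddfB.
have -> : (Q^t* *m Q) j j - ((P^t* *m Q)^t* *m (P^t* *m Q)) j j =
    (((1%:M - P *m P^t*) *m Q)^t* *m ((1%:M - P *m P^t*) *m Q)) j j.
  rewrite [in RHS]gramM.
  have -> : (1%:M - P *m P^t*)^t* *m (1%:M - P *m P^t*) = 1%:M - P *m P^t*.
    rewrite adjB adj1 adjM trmxCK mulmxBr mulmx1 mulmxBl mul1mx.
    by rewrite mulmxA -(mulmxA P _ P) PP Pe subrr subr0.
  by rewrite mulmxBr mulmxBl mulmx1 gramM trmxCK [in RHS]mxE [in X in _ = _ + X]mxE.
rewrite gram_diagE /=.
by apply: sumr_ge0 => i _; rewrite addr_ge0 ?sqr_ge0.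
Qed.

(** With [G = P^* Q] and [U = V W^*], the trace has real part sum of [s_i t_j Re(G_ij U_ji)]. Each
    [Re(G_ij U_ji)] is at most the mean [S_ij] of [|G_ij|^2] and [|U_ji|^2], and [S] is doubly
    substochastic: by Bessel's inequality for [G], by unitarity for [U]. *)
Lemma von_neumann_trace A B W V s t : right_svd A W s -> right_svd B V t ->
  complex.Re (\tr (A^t* *m B)) <= \sum_j s 0 j * t 0 j.
Proof.
move=> svdA svdB; have [P [AP PP]] := right_svd_factor svdA.
have [Q [BQ QQ]] := right_svd_factor svdB.
case: svdA => Wu _ s0 sdec; case: svdB => Vu _ t0 tdec.
have trE (X Y : 'M[R[i]]_n) :
    complex.Re (\tr (rdiag s *m X *m rdiag t *m Y)) =
    \sum_i \sum_j s 0 i * t 0 j * complex.Re (X i j * Y j i).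
  rewrite raddf_sum; apply: eq_bigr => i _; rewrite mxE raddf_sum.
  apply: eq_bigr => j _; rewrite mul_mx_diag mul_diag_mx !mxE.
  by case: (X i j) (Y j i) => [a b] [c d] /=; ring.
pose G := P^t* *m Q; pose U := V *m W^t*.
have Uu : U \is unitarymx by rewrite mul_unitarymx ?trmxC_unitary.
pose sq (z : R[i]) : R := complex.Re z ^+ 2 + complex.Im z ^+ 2.
have sq_ge0 z : 0 <= sq z by rewrite addr_ge0 ?sqr_ge0.
have sq_col k l (M : 'M[R[i]]_(k, l)) j :
    \sum_i sq (M i j) = complex.Re ((M^t* *m M) j j) by rewrite gram_diagE.
have sqJ z : sq (Num.conj z) = sq z by case: z => x y; rewrite /sq /= sqrrN.
have sq_row k l (M : 'M[R[i]]_(k, l)) i :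
    \sum_j sq (M i j) = complex.Re ((M *m M^t*) i i).
  rewrite -{2}(trmxCK M) -sq_col.
  by apply: eq_bigr => j _; rewrite !mxE sqJ.
have diag_le1 (u : 'rV[R]_n) j :
    complex.Re (rdiag (\row_j (u 0 j != 0)%:R) j j) <= 1.
  by rewrite rdiagE eqxx mulr1n mxE /= lern1 leq_b1.
have Gcol j : \sum_i sq (G i j) <= 1.
  rewrite sq_col; apply: le_trans (bessel Q j PP) _.
  by rewrite QQ diag_le1.
have Grow i : \sum_j sq (G i j) <= 1.
  rewrite sq_row /G adjM trmxCK.
  have := bessel P i QQ; rewrite adjM trmxCK => /le_trans; apply.
  by rewrite PP diag_le1.
have Ucol j : \sum_i sq (U i j) = 1.
  by rewrite sq_col (unitarymxPl Uu) mxE eqxx.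
have Urow i : \sum_j sq (U i j) = 1.
  by rewrite sq_row (unitarymxP Uu) mxE eqxx.
have -> : complex.Re (\tr (A^t* *m B)) =
    \sum_i \sum_j s 0 i * t 0 j * complex.Re (G i j * U j i).
  have -> : \tr (A^t* *m B) = \tr (rdiag s *m G *m rdiag t *m U).
    rewrite AP BQ !adjM rdiag_adj /G /U -!mulmxA mxtrace_mulC.
    by rewrite -!mulmxA.
  exact: trE.
pose S i j := (sq (G i j) + sq (U j i)) / 2.
apply: le_trans (substochastic_sum_le (S := S) s0 sdec t0 tdec _ _ _).
- apply: ler_sum => i _; apply: ler_sum => j _.
  rewrite ler_wpM2l ?mulr_ge0 // /S /sq.
  case: (G i j) (U j i) => [a b] [c d] /=.
  rewrite ler_pdivlMr // -subr_ge0.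
  have -> : a ^+ 2 + b ^+ 2 + (c ^+ 2 + d ^+ 2) - (a * c - b * d) * 2 =
    (a - c) ^+ 2 + (b + d) ^+ 2 by ring.
  by rewrite addr_ge0 ?sqr_ge0.
- by move=> i j; apply: divr_ge0 => //; apply: addr_ge0; exact: sq_ge0.
- move=> i; rewrite -mulr_suml big_split /= Ucol ler_pdivrMr //.
  by rewrite mul1r lerD2r.
- move=> j; rewrite -mulr_suml big_split /= Urow ler_pdivrMr //.
  by rewrite mul1r lerD2r.
Qed.

(* Mirsky's inequality for the Frobenius norm. *)
Lemma right_svd_dist A B W V s t : right_svd A W s -> right_svd B V t ->
  \sum_j (s 0 j - t 0 j) ^+ 2 <= complex.Re (\tr ((A - B)^t* *m (A - B))).
Proof.
move=> svdA svdB; have vN := von_neumann_trace svdA svdB.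
have vN' : complex.Re (\tr (B^t* *m A)) <= \sum_j s 0 j * t 0 j.
  have := von_neumann_trace svdB svdA.
  by under eq_bigr do rewrite mulrC.
rewrite adjB mulmxBr !mulmxBl !raddfB /= (right_svd_norm svdA) (right_svd_norm svdB).
under eq_bigr do rewrite sqrrB -mulr_natl.
rewrite !big_split /= sumrN -mulr_sumr; lra.
Qed.

(** If [s_i] were nonzero, so would be all earlier entries; inverting their squares writes the
    identity block of rank [i + 1] as a product with [A] among its factors. *)
Lemma right_svd_rank A W s (i : 'I_n) : right_svd A W s ->
  (\rank A <= i)%N -> s 0 i = 0.
Proof.
case=> Wu AA s0 sdec rA; apply/eqP; apply: contraTT rA => si0; rewrite -ltnNge.
have spos (j : 'I_n) : (j <= i)%N -> s 0 j != 0.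
  move=> ji; rewrite gt_eqF // (lt_le_trans _ (sdec _ _ ji)) //.
  by rewrite lt_neqAle eq_sym si0 s0.
have -> : i.+1 = \rank (pid_mx i.+1 : 'M[R[i]]_n) by rewrite rank_pid_mx.
pose u : 'rV[R]_n := \row_j ((s 0 j) ^- 2 *+ (j < i.+1)%N).
have -> : pid_mx i.+1 = rdiag u *m (W *m (A^t* *m A) *m W^t*).
  rewrite AA !mulmxA (mulmxtVK _ Wu) -(mulmxA _ W) (unitarymxP Wu) mulmx1 rdiagM.
  apply/matrixP => j k; rewrite rdiagE !mxE.
  have [<-|jk] := eqVneq j k; last by rewrite (negbTE (jk : j != k :> nat)).
  rewrite eqxx ltnS; case: leqP => [ji|_]; last by rewrite mulr0n mul0r.
  by rewrite !mulr1n mulVf ?expf_neq0 ?spos.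
apply: leq_trans (mxrankM_maxr _ _) _; apply: leq_trans (mxrankM_maxl _ _) _.
by apply: leq_trans (mxrankM_maxr _ _) _; exact: mxrankM_maxr.
Qed.

Lemma right_svd_rank_le A W s (k : nat) : right_svd A W s ->
  (forall j : 'I_n, (k <= j)%N -> s 0 j = 0) -> (\rank A <= k)%N.
Proof.
move=> svdA sk; have [P [-> _]] := right_svd_factor svdA.
apply: leq_trans (mxrankM_maxl _ _) _; apply: leq_trans (mxrankM_maxr _ _) _.
by apply: rank_diag_mx_le => j /sk sj; rewrite mxE sj.
Qed.

End SingularFactor.

(** * The error bound from a distance estimate on Omega *)

(** Cauchy-Schwarz against the indicator of [P], obtained by expanding the sum of the squares
    [(N x_i - S)^2]. *)
Lemma sum_le_sqrt_card (R : realType) (I : finType) (P : pred I) (x : I -> R) :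
  \sum_(i | P i) x i <= Num.sqrt #|P|%:R * Num.sqrt (\sum_i x i ^+ 2).
Proof.
have [N0|N0] := posnP #|P|.
  by rewrite big_pred0 ?mulr_ge0 ?sqrtr_ge0 // => i; move/card0_eq: N0 => /(_ i).
rewrite -sqrtrM ?ler0n //; apply: le_trans (ler_norm _) _; rewrite -sqrtr_sqr.
apply: ler_wsqrtr; set S := \sum_(i | P i) x i; set N : R := #|P|%:R.
have Ngt0 : 0 < N by rewrite ltr0n.
rewrite -subr_ge0 -(pmulr_rge0 _ Ngt0).
have : 0 <= \sum_(i | P i) (N * x i - S) ^+ 2 by apply: sumr_ge0 => i _; rewrite sqr_ge0.
have -> : \sum_(i | P i) (N * x i - S) ^+ 2 =
    N ^+ 2 * (\sum_(i | P i) x i ^+ 2) - 2 * N * S * S + S ^+ 2 * N.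
  transitivity (\sum_(i | P i) (N ^+ 2 * x i ^+ 2 + - (2 * N * S) * x i + S ^+ 2)).
    by apply: eq_bigr => i _; ring.
  rewrite !big_split /= -!mulr_sumr sumr_const -/S.
  by rewrite mulNr -(mulr_natr S) -/N mulrA -expr2.
have : \sum_(i | P i) x i ^+ 2 <= \sum_i x i ^+ 2.
  rewrite [leRHS](bigID P) /= lerDl.
  by apply: sumr_ge0 => i _; rewrite sqr_ge0.
set T := \sum_(i | P i) x i ^+ 2; set T' := \sum_i _ => TT'.
have : N ^+ 2 * T <= N ^+ 2 * T' by rewrite ler_wpM2l ?sqr_ge0.
nra.
Qed.

(** * The tail of the singular values *)

Section TailSum.
Variables (R : realType) (s : mxspace) (kappa : nat).
Implicit Types X Y Z : mat R s.

Lemma innerBl X Y Z : inner (X - Y) Z = inner X Z - inner Y Z.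
Proof. by rewrite innerDl -(scaleN1r Y) innerZl mulN1r. Qed.

Lemma innerNr X Y : inner X (- Y) = - inner X Y.
Proof. by rewrite -(scaleN1r Y) innerZr mulN1r. Qed.

Lemma cmxB X Y : cmx (X - Y) = cmx X - cmx Y.
Proof. by rewrite cmxD -(scaleN1r Y) cmxZ rmorphN1 scaleN1r. Qed.

Lemma mat_norm_svd X Y W V t u :
  right_svd (cmx X) W t -> right_svd (cmx Y) V u ->
  Num.sqrt (\sum_j (t 0 j - u 0 j) ^+ 2) <= `|X - Y|.
Proof.
move=> sX sY; apply: ler_wsqrtr; apply: le_trans (right_svd_dist sX sY) _.
by rewrite /inner cmxB.
Qed.

(** Keeping the cutoff at [mindim s] leaves at most [mindim s] terms, which is what the Lipschitz
    constant of the tail rests on. *)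
Lemma tail_sum_trunc X W t : right_svd (cmx X) W t ->
  tail_sum kappa X =
  \sum_(j < ncols s | (kappa <= j)%N && (j < mindim s)%N) t 0 j.
Proof.
move=> sX; rewrite /tail_sum (big_nat_widen _ _ (ncols s)) ?geq_minr //.
rewrite (big_nat_widenl _ 0) // big_mkord.
apply: eq_big => [j|j _]; first by rewrite andbC.
exact: (nth_singular_values j sX).
Qed.

(** The entries from index [mindim s] on vanish, since the rank is at most [mindim s]. *)
Lemma tail_sumE X W t : right_svd (cmx X) W t ->
  tail_sum kappa X = \sum_(j < ncols s | (kappa <= j)%N) t 0 j.
Proof.
move=> sX; rewrite (tail_sum_trunc sX) [RHS](bigID (fun j : 'I__ => (j < mindim s)%N)) /=.
rewrite [X in _ = _ + X]big1 ?addr0 // => j /andP[_]; rewrite -leqNgt => sj.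
apply: (right_svd_rank sX); apply: leq_trans sj.
by rewrite leq_min rank_leq_row rank_leq_col.
Qed.

Lemma tail_sum_ge0 X : 0 <= tail_sum kappa X.
Proof.
have [W [t sX]] := right_svd_exists (cmx X).
by rewrite (tail_sumE sX); apply: sumr_ge0 => j _; case: sX.
Qed.

Lemma tail_sum_eq0 X : tail_sum kappa X = 0 <-> (\rank (cmx X) <= kappa)%N.
Proof.
have [W [t sX]] := right_svd_exists (cmx X); rewrite (tail_sumE sX); split.
  move=> /eqP; rewrite psumr_eq0; last by case: sX.
  move=> /allP t0; apply: (right_svd_rank_le sX) => j kj.
  by have := t0 j; rewrite mem_index_enum kj => /(_ isT)/eqP.
move=> rX; apply: big1 => j kj.
by apply: (right_svd_rank sX); exact: leq_trans kj.
Qed.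

(** The difference of the tails is a sum of at most [mindim s] differences of singular values:
    Cauchy-Schwarz, then Mirsky's inequality. *)
Lemma tail_sum_lipschitz X Y :
  tail_sum kappa Y <= tail_sum kappa X + Num.sqrt (mindim s)%:R * `|X - Y|.
Proof.
have [W [t sX]] := right_svd_exists (cmx X).
have [V [u sY]] := right_svd_exists (cmx Y).
rewrite (tail_sum_trunc sX) (tail_sum_trunc sY) -lerBlDl -sumrB distrC.
apply: le_trans (sum_le_sqrt_card _ _) _; apply: ler_pM; rewrite ?sqrtr_ge0 //.
  apply: ler_wsqrtr; rewrite ler_nat.
  apply: (@leq_trans #|[pred j : 'I_(ncols s) | (j < mindim s)%N]|).
    by apply: subset_leq_card; apply/fintype.subsetP => j; rewrite !inE => /andP[].
  by rewrite -sum1_card big_ord_narrow ?geq_minr // sum1_card card_ord.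
exact: mat_norm_svd sY sX.
Qed.

Lemma tail_sum_continuous : continuous (tail_sum kappa : mat R s -> R^o).
Proof.
set L := Num.sqrt (mindim s)%:R : R.
have L0 : 0 <= L by exact: sqrtr_ge0.
move=> X; apply/(@cvgrPdist_le _ _ _ _ (nbhs_filter X)) => e e0; near=> Y.
(* Dividing by [L + 1] instead of [L] covers the case [L = 0]. *)
have XY : `|X - Y| <= e / (L + 1).
  near: Y; apply: cvgr_dist_le; first exact: cvg_id.
  by rewrite divr_gt0 // ltr_wpDl.
have {}XY : L * `|X - Y| <= e.
  apply: le_trans (ler_wpM2l L0 XY) _.
  rewrite mulrCA; apply: ler_piMr; first exact: ltW.
  by rewrite ler_pdivrMr ?mul1r ?lerDl // ltr_wpDl.
have := tail_sum_lipschitz X Y; have := tail_sum_lipschitz Y X.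
rewrite -/L (distrC Y) ler_norml; move: XY.
move: (L * _) (tail_sum kappa X) (tail_sum kappa Y) => d a b *; lra.
Unshelve. all: by end_near.
Qed.

End TailSum.

(** * First-order consequences of convexity *)

Section FirstOrder.
Variables (R : realType) (s : mxspace) (f : mat R s -> R^o) (gradf : mat R s -> mat R s).

(** The derivative along [Y - X] is the limit of right difference quotients, each of which is at
    most [f Y - f X] by convexity. *)
Lemma convex_gradient X Y : is_gradient f gradf -> convex_function setT f ->
  inner (gradf X) (Y - X) <= f Y - f X.
Proof.
move=> /(_ X)[dfX gX] cf; rewrite -gX -deriveE //.
have dX : derivable f X (Y - X) by exact: diff_derivable.
rewrite /derive cvg_at_rightE //; apply: limr_le.
  exact: (cvgP _ (cvg_dnbhs_at_right dX)).
near=> h.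
have h0 : 0 < h by [].
have h1 : h <= 1 by near: h; exact: nbhs_right_le.
have h01 : Itv.spec (Itv.num_sem (R := R)) (Itv.Real `[0%Z, 1%Z]) h.
  by rewrite /Itv.spec /Itv.num_sem num_real /= in_itv; apply/andP; split => //=; exact: ltW.
have := cf (Itv.Def h01) Y X; rewrite !in_setT => /(_ isT isT).
have -> : conv (Itv.Def h01) (Y : convex_lmodType _) X = h *: (Y - X) + X.
  rewrite /conv /=.
  by rewrite scalerBr /unstable.onem scalerBl scale1r addrA [RHS]addrAC.
rewrite convRE /= /unstable.onem => le.
rewrite /GRing.scale /= ler_pdivrMl //; move: le.
move: (f (h *: (Y - X) + X)) (f X) (f Y) => a b c *; lra.
Unshelve. all: by end_near.
Qed.

Lemma gradient_monotone_bound X Y : is_gradient f gradf -> convex_function setT f ->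
  f X - f Y - inner (gradf Y) (X - Y) <= `|gradf X - gradf Y| * `|X - Y|.
Proof.
move=> gf cf; apply: le_trans (inner_CauchySchwarz _ _).
rewrite innerBl lerD2r.
have := convex_gradient X Y gf cf; rewrite -(opprB X Y) innerNr.
move: (inner _ _) (f X) (f Y) => a b c *; lra.
Qed.

End FirstOrder.

(** [xp], [xz], [xy], [yz] stand for distances between [X], its projection [P], a point [Y] of Omega
    and a point [Z] of F near [Y]; [tX] and [tY] are tails and [L] is their Lipschitz constant. *)
Lemma perturbed_bound (R : realFieldType) (c L tX tY xy yz xp xz : R) :
  0 <= c -> xp <= xz -> xz <= xy + yz -> tY <= tX + L * xy -> yz <= c * tY ->
  xp - c * tX <= (1 + c * L) * xy.
Proof. by move=> c0 h1 h2 /(ler_wpM2l c0); rewrite mulrDr mulrDl mul1r mulrA; lra. Qed.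

(** Away from F the tail [u] exceeds a fixed [t], while the distance [yz] to a fixed point of F is
    at most [d + 1]; so every [c] above [(d + 1) / t] will do. *)
Lemma far_bound (R : realFieldType) (c t d u xy yz : R) :
  0 < t -> 0 <= d -> (d + 1) / t < c -> t < u -> xy < 1 -> yz <= xy + d ->
  yz <= c * u.
Proof.
move=> t0 d0 dc tu xy1 yzd; have c0 : 0 < c.
  by apply: le_lt_trans dc; rewrite divr_ge0 ?addr_ge0 // ltW.
have : c * t <= c * u by rewrite ler_wpM2l ?(ltW c0) ?(ltW tu).
by move: dc; rewrite ltr_pdivrMr //; lra.
Qed.

(** From [t d^2 <= q <= g d], divide by [t d]. *)
Lemma quotient_bound (R : realFieldType) (t q d g : R) :
  0 < t -> 0 < d -> t <= q / d ^+ 2 -> q <= g * d -> d <= t^-1 * g.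
Proof.
move=> t0 d0; rewrite ler_pdivlMr ?exprn_gt0 // => tq qg.
by rewrite ler_pdivlMl // -(ler_pM2r d0) -mulrA -expr2 (le_trans tq).
Qed.

Section ErrorBound.
Variables (R : realType) (s : mxspace) (Omega : set (mat R s)) (kappa : nat).
Variables (f : mat R s -> R^o) (gradf : mat R s -> mat R s).
Let F := low_rank Omega kappa.
Hypothesis asm : assumptions Omega kappa f gradf.

Lemma minimizer_dist P Xs : F P -> minimizers f F Xs ->
  (`|P - Xs|%:E <= (theta Omega kappa f gradf)^-1 * `|gradf P - gradf Xs|%:E)%E.
Proof.
move=> FP FXs; have th0 := theta_gt0 asm.
(* Equal points do not enter the infimum; the left-hand side is then 0. *)
have [->|PXs] := eqVneq P Xs.
  rewrite subrr normr0; apply: mule_ge0; last by rewrite lee_fin.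
  by rewrite inve_ge0; exact: ltW.
have d0 : 0 < `|P - Xs| by rewrite normr_gt0 subr_eq0.
have := @ereal_inf_lbound R _ _ (ex_intro _ P (ex_intro _ Xs
  (And4 FP FXs (elimN eqP PXs) erefl)) : [set r | exists X Y, [/\ F X, minimizers f F Y, X <> Y &
    r = ((f X - f Y - inner (gradf Y) (X - Y)) / `|X - Y| ^+ 2)%:E]] _).
rewrite -/(theta _ _ _ _).
(* [theta] is finite: it is positive, and the quotient at [P] and [Xs] bounds it from above. *)
case: (theta Omega kappa f gradf) th0 => [t|//|//].
rewrite lte_fin lee_fin => t0.
rewrite inver (gt_eqF t0) -EFinM lee_fin => tq.
apply: (quotient_bound t0 d0 tq).
exact: gradient_monotone_bound (f_gradient asm) (f_convex asm).
Qed.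

Lemma error_bound_of_tail c : 0 <= c ->
  (forall Y, Omega Y -> exists2 Z, F Z & `|Y - Z| <= c * tail_sum kappa Y) ->
  error_bound Omega kappa f gradf c.
Proof.
move=> c0 tailF X P Xs [FP Pmin] FXs.
have dX : dist X (minimizers f F) <= `|X - P| + `|P - Xs|.
  apply: le_trans (ler_distD P X Xs); apply: ge_inf; last by exists Xs.
  by exists 0 => _ [y _ <-].
have dF : `|X - P| <= (1 + c * Num.sqrt (mindim s)%:R) * dist X Omega + c * tail_sum kappa X.
  set L := Num.sqrt _; have L0 : 0 <= L by exact: sqrtr_ge0.
  have k0 : 0 < 1 + c * L by rewrite ltr_pwDl // mulr_ge0.
  have key Y : Omega Y -> `|X - P| - c * tail_sum kappa X <= (1 + c * L) * `|X - Y|.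
    move=> OY; have [Z FZ YZ] := tailF Y OY.
    exact: perturbed_bound c0 (Pmin Z FZ) (ler_distD Y X Z)
      (tail_sum_lipschitz kappa X Y) YZ.
  (* [key] holds for every [Y] in Omega, so [|X - Y|] may be replaced by its infimum over Omega,
     which is nonempty because F is. *)
  rewrite -lerBlDr -(ler_pdivrMl _ _ k0); apply: lb_le_inf.
    by have [Y [OY _]] := F_nonempty asm; exists `|X - Y|, Y.
  by move=> _ [Y OY <-]; rewrite (ler_pdivrMl _ _ k0); exact: key.
apply: (@le_trans _ _ (`|X - P| + `|P - Xs|)%:E); first by rewrite lee_fin.
rewrite -[X in (_ <= X + _)%E]EFinD (EFinD `|X - P|).
by apply: leeD; [rewrite lee_fin | exact: minimizer_dist].
Qed.

Lemma tail_error_bound : exists2 c, 0 < c &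
  forall Y, Omega Y -> exists2 Z, F Z & `|Y - Z| <= c * tail_sum kappa Y.
Proof.
have F0 : tail_level Omega kappa 0 = F.
  apply/seteqP; split=> X [OX /tail_sum_eq0 rX]; split=> //.
have [Z0 FZ0] := F_nonempty asm.
(* Compactness in its near-covering form: a property of [c] and [Y] that holds for all large [c] and
   all [Y] near each point of Omega holds for all large [c] uniformly on Omega. *)
have /compact_near_coveringP cO := Omega_compact asm.
have := cO R +oo (fun c Y => Omega Y -> exists2 Z, F Z & `|Y - Z| <= c * tail_sum kappa Y) _.
case=> [X OX|M [_ HM]]; last first.
  exists (Num.max M 0 + 1); first by rewrite ltr_wpDl // le_max lexx orbT.
  by move=> Y OY; apply: (HM _ _ Y) => //; rewrite ltr_pwDr // le_max lexx.
have tc := @tail_sum_continuous R s kappa X.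
have [tX0|tX] := eqVneq (tail_sum kappa X) 0.
  (* Calmness is used at the level [tail_sum kappa Y], whose level set contains [Y]; by continuity
     this level lies in [U] once [Y] is near [X]. *)
  have [al [al0 [U [V [nU nV calmX]]]]] := tail_calm asm (conj OX tX0).
  exists (V `&` (tail_sum kappa @^-1` U), [set c | al < c]); first split=> /=.
  - apply: filterI => //; apply: tc.
    by rewrite tX0.
  - by exists al; split=> //; rewrite num_real.
  move=> [Y c] [/= [VY UY] alc] OY.
  have [|Z] := calmX _ UY Y; first by split.
  rewrite F0 => FZ [b b1 eY]; exists Z => //.
  have -> : Y - Z = (al * `|tail_sum kappa Y - 0|) *: b.
    by rewrite -[X in X - _]eY addrAC subrr add0r.
  have tY0 := tail_sum_ge0 kappa Y; have bn : `|b| <= 1 := b1.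
  rewrite normrZ subr0 (ger0_norm tY0) ger0_norm ?mulr_ge0 //.
  apply: le_trans (ler_wpM2l _ bn) _; first exact: mulr_ge0.
  by rewrite mulr1; apply: ler_wpM2r => //; exact: ltW.
(* Off F the tail stays above half its value at [X] on a neighborhood of [X], and the fixed point
   [Z0] of F serves all [Y] there. *)
have tXgt0 : 0 < tail_sum kappa X by rewrite lt_neqAle eq_sym tX tail_sum_ge0.
set t := tail_sum kappa X in tXgt0 tc *.
exists ([set Y | t / 2 < tail_sum kappa Y] `&` [set Y | `|X - Y| < 1],
  [set c | (`|X - Z0| + 1) / (t / 2) < c]); first split=> /=.
- apply: filterI.
    by apply: (cvgr_gt t tc); rewrite ltr_pdivrMr // ltr_pMr // ltr1n.
  by have := @nbhsx_ballx R _ X 1 ltr01; rewrite -ball_normE.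
- by exists ((`|X - Z0| + 1) / (t / 2)); split=> //; rewrite num_real.
move=> [Y c] [/= [tY XY] cc] OY; exists Z0 => //.
have := ler_distD X Y Z0; rewrite (distrC Y X) => YZ.
exact: (far_bound (divr_gt0 tXgt0 (ltr0Sn R 1)) (normr_ge0 _) cc tY XY YZ).
Qed.

End ErrorBound.

(** * Real matrices in a norm ball *)

Section RealSpectral.
Variable R : realType.

(* The reflection exchanging [v] and the first basis vector. *)
Lemma householder (n : nat) (v : 'rV[R]_n.+1) : v *m v^T = 1%:M ->
  exists H : 'M[R]_n.+1,
    [/\ H^T = H, H *m H = 1%:M & delta_mx 0 0 *m H = v].
Proof.
move=> vv; pose e : 'rV[R]_n.+1 := delta_mx 0 0; pose w := v - e.
have [w0|w0] := eqVneq w 0.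
  exists 1%:M; rewrite trmx1 mulmx1 mulmx1; split=> //.
  by apply/esym/eqP; rewrite -subr_eq0 -/e -/w w0.
pose c := (w *m w^T) 0 0.
have wwE : w *m w^T = c%:M by exact: mx11_scalar.
have c0 : c != 0.
  apply: contra w0 => /eqP c0; apply/eqP/rowP => j; rewrite [RHS]mxE.
  have : \sum_k w 0 k ^+ 2 = 0.
    by rewrite -[RHS]c0 /c mxE; apply: eq_bigr => k _; rewrite !mxE expr2.
  move=> /eqP; rewrite psumr_eq0 => [/allP/(_ j)|k _]; last exact: sqr_ge0.
  by rewrite mem_index_enum sqrf_eq0 => /(_ isT)/eqP.
(* Since [v] and [e] are unit vectors, [|v - e|^2 = 2 - 2 v_0]; this makes the reflection along [w]
   send [e] to [e + w = v]. *)
have cE : c = 2 - 2 * v 0 0.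
  have ee : e *m e^T = 1%:M.
    by apply/matrixP => i j; rewrite trmx_delta mul_delta_mx !ord1 !mxE.
  have ve : v *m e^T = (v 0 0)%:M.
    by rewrite trmx_delta -colE; apply/matrixP => i j; rewrite !ord1 !mxE.
  have ev : e *m v^T = (v 0 0)%:M by rewrite -[LHS]trmxK trmx_mul trmxK ve tr_scalar_mx.
  rewrite /c /w raddfB /= mulmxBr !mulmxBl vv ee ve ev !mxE eqxx !mulr1n; ring.
have ew : e *m w^T = (v 0 0 - 1)%:M.
  rewrite /e -rowE; apply/matrixP => i j; rewrite !ord1 !mxE eqxx.
  by rewrite mulr1n.
exists (1%:M - (2 / c) *: (w^T *m w)); split.
- by rewrite raddfB /= trmx1 linearZ /= trmx_mul trmxK.
- rewrite mulmxBr mulmx1 mulmxBl mul1mx -scalemxAl -scalemxAr.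
  rewrite mulmxA -(mulmxA w^T w) wwE mul_mx_scalar -scalemxAl !scalerA.
  rewrite -addrA -opprD -!scalerBl -scalerDl.
  rewrite [X in X *: _](_ : _ = 0) ?scale0r ?subr0 //.
  by field.
- rewrite -/e mulmxBr mulmx1 -scalemxAr mulmxA ew mul_scalar_mx scalerA.
  have -> : 2 / c * (v 0 0 - 1) = -1.
    by rewrite cE; field; rewrite -cE.
  by rewrite scaleN1r opprK /w addrC subrK.
Qed.

(** Over the complex numbers the matrix is Hermitian, so its characteristic polynomial has a real
    root; that polynomial has real coefficients, so the root is already an eigenvalue over [R]. *)
Lemma real_symmetric_eigenvector (n : nat) (A : 'M[R]_n.+1) : A^T = A ->
  exists (a : R) (v : 'rV[R]_n.+1), v *m A = a *: v /\ v *m v^T = 1%:M.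
Proof.
move=> sA; pose A' := map_mx (real_complex R) A.
have hA : A' \is hermsymmx.
  apply/is_hermitianmxP; rewrite expr0 scale1r; apply/matrixP => i j.
  by rewrite !mxE -[in LHS]sA mxE; exact/esym/conjc_real.
have AE := orthomx_spectralP (hermitian_normalmx hA).
have /mxOverP/(_ 0 0) := hermitian_spectral_diag_real hA.
move=> /complex_realP[a aE].
have : root (char_poly A') a%:C.
  rewrite AE char_poly_similar ?unitarymx_unit ?spectral_unitarymx //.
  rewrite char_poly_trig ?diag_mx_is_trig // -aE (bigD1 ord0) //=.
  by rewrite mxE eqxx mulr1n rootM root_XsubC eqxx.
rewrite -map_char_poly fmorph_root -eigenvalue_root_char.
move=> /eigenvalueP[v vA v0]; pose c := (v *m v^T) 0 0.
have c0 : 0 < c.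
  rewrite /c mxE lt_neqAle eq_sym; apply/andP; split; last first.
    by apply: sumr_ge0 => k _; rewrite !mxE -expr2 sqr_ge0.
  apply: contra v0; rewrite psumr_eq0 => [/allP vk|k _]; last first.
    by rewrite !mxE -expr2 sqr_ge0.
  apply/eqP/rowP => k; have := vk k; rewrite mem_index_enum !mxE -expr2 sqrf_eq0.
  by move=> /(_ isT)/eqP.
exists a, ((Num.sqrt c)^-1 *: v); split.
  by rewrite -scalemxAl vA !scalerA mulrC.
rewrite linearZ /= -scalemxAl -scalemxAr scalerA [v *m _]mx11_scalar -/c.
rewrite scale_scalar_mx -invfM -expr2 sqr_sqrtr ?ltW // mulVf ?gt_eqF //.
Qed.

(** Induction by deflation along one eigenvector. A real orthogonal factor is wanted because the
    truncation of a real matrix must be real. *)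
Lemma real_spectral (n : nat) (A : 'M[R]_n) : A^T = A ->
  exists (Q : 'M[R]_n) (d : 'rV[R]_n), Q *m Q^T = 1%:M /\ A = Q^T *m diag_mx d *m Q.
Proof.
elim: n A => [|n IHn] A sA.
  by exists 1%:M, 0; split; [rewrite trmx1 mulmx1 | apply/matrixP => -[]].
have [a [v [vA vv]]] := real_symmetric_eigenvector sA.
have [H [sH HH vE]] := householder vv.
pose B : 'M[R]_(1 + n) := H *m A *m H.
have sB : B^T = B by rewrite /B !trmx_mul sA sH mulmxA.
(* [H] exchanges the eigenvector and the first basis vector, so the first row of [B] is [a] times
   the latter; by symmetry the first column is too, and [B] is block diagonal. *)
have B0 : row 0 B = a *: delta_mx 0 0.
  rewrite rowE /B !mulmxA vE vA -scalemxAl -vE -mulmxA HH mulmx1.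
  by [].
have HBH : H *m B *m H = A.
  by rewrite /B !mulmxA HH mul1mx -mulmxA HH mulmx1.
clearbody B; have B0E j : B 0 j = a * (j == 0)%:R.
  by have /rowP/(_ j) := B0; rewrite !mxE eqxx.
have BE : B = block_mx a%:M 0 0 (drsubmx B).
  rewrite -[LHS]submxK; congr block_mx; apply/matrixP => i j; rewrite !mxE ?ord1.
  - by rewrite (_ : lshift n 0 = 0) ?B0E ?eqxx ?mulr1 //; exact: val_inj.
  - by rewrite (_ : lshift n 0 = 0) ?B0E ?mulr0 //; exact: val_inj.
  - by rewrite -sB mxE (_ : lshift n 0 = 0) ?B0E ?mulr0 //; exact: val_inj.
have [|Q [d [QQ BQ]]] := IHn (drsubmx B).
  by rewrite trmx_drsub sB.
pose P : 'M[R]_(1 + n) := block_mx 1%:M 0 0 Q.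
pose c : 'rV[R]_(1 + n) := row_mx a%:M d.
have PP : P *m P^T = 1%:M.
  rewrite tr_block_mx !trmx0 trmx1 mulmx_block !mulmx0 !mul0mx mulmx1 QQ.
  by rewrite !addr0 add0r -scalar_mx_block.
have BP : B = P^T *m diag_mx c *m P.
  rewrite diag_mx_row tr_block_mx !trmx0 trmx1 !mulmx_block.
  rewrite !mulmx0 !mul0mx !mulmx1 !mul1mx !addr0 !add0r -BQ.
  rewrite {1}BE; congr block_mx; rewrite ?mul0mx ?mulmx0 //.
  by apply/matrixP => i j; rewrite !ord1 !mxE eqxx.
exists (P *m H : 'M[R]_(1 + n)), c; split.
  by rewrite trmx_mul sH -mulmxA (mulmxA H H) HH mul1mx.
by rewrite trmx_mul sH -HBH BP !mulmxA.
Qed.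

Lemma real_spectral_sorted (n : nat) (A : 'M[R]_n) : A^T = A ->
  exists (Q : 'M[R]_n) (d : 'rV[R]_n), [/\ Q *m Q^T = 1%:M,
    A = Q^T *m diag_mx d *m Q & forall i j : 'I_n, (i <= j)%N -> d 0 j <= d 0 i].
Proof.
move=> /real_spectral[Q [d [QQ ->]]].
have [p pP] := ord_sort_perm (fun j => d 0 j).
exists (row_perm p Q), (col_perm p d); split.
- by rewrite tr_row_perm row_perm_mul1.
- by rewrite tr_row_perm diag_mx_row_perm.
- by move=> i j ij; rewrite !mxE pP.
Qed.

Lemma cmx_real_adj (m n : nat) (A : 'M[R]_(m, n)) :
  (map_mx (real_complex R) A)^t* = map_mx (real_complex R) A^T.
Proof. by apply/matrixP => i j; rewrite !mxE; exact: conjc_real. Qed.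

Lemma right_svd_real (m n : nat) (X : 'M[R]_(m, n)) :
  exists (Q : 'M[R]_n) (s : 'rV[R]_n),
    right_svd (map_mx (real_complex R) X) (map_mx (real_complex R) Q) s.
Proof.
have [|Q [d [QQ XX dec]]] := @real_spectral_sorted n (X^T *m X).
  by rewrite trmx_mul trmxK.
have d0 j : 0 <= d 0 j.
  have : Q *m (X^T *m X) *m Q^T = diag_mx d.
    by rewrite XX !mulmxA QQ mul1mx -mulmxA QQ mulmx1.
  move=> /(congr1 (fun M : 'M[R]_n => M j j)); rewrite [in RHS]mxE eqxx mulr1n => <-.
  rewrite mulmxA -(trmxK Q) -trmx_mul trmxK -mulmxA mxE.
  by apply: sumr_ge0 => i _; rewrite mxE -expr2 sqr_ge0.
exists Q, (\row_j Num.sqrt (d 0 j)); split.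
- by apply/unitarymxP; rewrite cmx_real_adj -map_mxM QQ map_mx1.
- rewrite !cmx_real_adj -map_mxM XX !map_mxM map_diag_mx; congr (_ *m _ *m _).
  by congr diag_mx; apply/rowP => j; rewrite !mxE sqr_sqrtr.
- by move=> j; rewrite mxE sqrtr_ge0.
- by move=> i j ij; rewrite !mxE ler_wsqrtr // dec.
Qed.

End RealSpectral.

(** * Truncated singular value decompositions *)

Section Truncation.
Variables (R : realType) (m n : nat) (A : 'M[R[i]]_(m, n)) (W : 'M[R[i]]_n) (s : 'rV[R]_n).
Hypothesis svdA : right_svd A W s.
Implicit Types e g : 'rV[R]_n.

(** [A *m W^t* *m rdiag e *m W] is [A] with each singular value [s_j] scaled by [e_j]; products of
    two such matrices are computed entrywise in [e] and [g]. *)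
Lemma svd_filterM e g :
  (A *m W^t* *m rdiag e *m W)^t* *m (A *m W^t* *m rdiag g *m W) =
  W^t* *m rdiag (\row_j (e 0 j * g 0 j * s 0 j ^+ 2)) *m W.
Proof.
rewrite -!(mulmxA (A *m W^t*)) adjM -mulmxA (mulmxA ((A *m W^t*)^t*)).
rewrite (right_svd_gram svdA) adjM rdiag_adj !mulmxA.
rewrite -(mulmxA (W^t*)) rdiagM -(mulmxA (W^t*)) rdiagM.
apply: (congr1 (fun d => W^t* *m rdiag d *m W)).
by apply/rowP => j; rewrite !mxE mulrAC.
Qed.

Lemma tr_svd_filterM e g :
  complex.Re (\tr ((A *m W^t* *m rdiag e *m W)^t* *m (A *m W^t* *m rdiag g *m W))) =
  \sum_j e 0 j * g 0 j * s 0 j ^+ 2.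
Proof.
rewrite svd_filterM mxtrace_mulC mulmxA; case: svdA => /unitarymxP-> _ _ _.
by rewrite mul1mx tr_rdiag /=; apply: eq_bigr => j _; rewrite mxE.
Qed.

End Truncation.

Lemma sum_sqr_le (R : realDomainType) (I : finType) (P : pred I) (x : I -> R) :
  (forall i, P i -> 0 <= x i) ->
  \sum_(i | P i) x i ^+ 2 <= (\sum_(i | P i) x i) ^+ 2.
Proof.
move=> x0; rewrite [leRHS]expr2 mulr_suml; apply: ler_sum => i Pi.
rewrite expr2 ler_wpM2l ?x0 // (bigD1 i) //= lerDl.
by apply: sumr_ge0 => j /andP[Pj _]; exact: x0.
Qed.

Lemma sqr_mat_norm (R : realType) (s : mxspace) (X : mat R s) :
  `|X| ^+ 2 = inner X X.
Proof. by rewrite mat_normE sqr_sqrtr ?inner_ge0. Qed.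

Lemma mat_pythagoras (R : realType) (s : mxspace) (X Y : mat R s) :
  inner X Y = 0 -> `|X + Y| ^+ 2 = `|X| ^+ 2 + `|Y| ^+ 2.
Proof.
move=> XY; have e : inner (X + Y) (X + Y) = inner X X + inner Y Y.
  by rewrite innerDl 2!innerDr (innerC Y X) XY addr0 add0r.
rewrite [LHS]sqr_mat_norm e; congr (_ + _); exact/esym/sqr_mat_norm.
Qed.

Lemma hypotenuse_le (R : rcfType) (h x y k : R) :
  0 <= x -> 0 <= y -> 0 <= k -> h ^+ 2 = x ^+ 2 + y ^+ 2 -> y <= k * x ->
  h <= Num.sqrt (1 + k ^+ 2) * x.
Proof.
move=> x0 y0 k0 hE yk; apply: le_trans (ler_norm h) _.
rewrite -[leRHS]ger0_norm ?mulr_ge0 ?sqrtr_ge0 // -!sqrtr_sqr ler_wsqrtr // hE.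
rewrite exprMn sqr_sqrtr ?addr_ge0 ?sqr_ge0 // mulrDl mul1r lerD2l -exprMn.
by rewrite ler_pXn2r // nnegrE mulr_ge0.
Qed.

Section RealTruncation.
Variables (R : realType) (n1 n2 kappa : nat).
Implicit Types X : mat R (RealMx n1 n2).

(** [T] keeps the first [kappa] singular values and [X - T] the others. The supports are disjoint,
    hence the orthogonality; the norm of [X - T] is the Euclidean norm of the tail, at most its
    sum. *)
Lemma real_truncation X : exists T : mat R (RealMx n1 n2),
  [/\ (\rank (cmx T) <= kappa)%N, inner (X - T) T = 0 &
    `|X - T| <= tail_sum kappa X].
Proof.
have [Q [s svdX]] := right_svd_real (X : 'M[R]_(n1, n2)).
pose e : 'rV[R]_n2 := \row_j (j < kappa)%N%:R.
pose T : mat R (RealMx n1 n2) := (X : 'M[R]_(n1, n2)) *m Q^T *m diag_mx e *m Q.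
set W := map_mx _ Q in svdX.
have TE : cmx T = cmx X *m W^t* *m rdiag e *m W.
  by rewrite /T /= !map_mxM map_diag_mx cmx_real_adj.
have XTE : cmx (X - T) = cmx X *m W^t* *m rdiag (const_mx 1 - e) *m W.
  rewrite cmxB TE rdiagB rdiag1 mulmxBr mulmxBl mulmx1; congr (_ - _).
  by case: svdX => Wu _ _ _; rewrite -mulmxA unitarymxPl ?mulmx1.
exists T; split.
- rewrite TE; apply: leq_trans (mxrankM_maxl _ _) _; apply: leq_trans (mxrankM_maxr _ _) _.
  by apply: rank_diag_mx_le => j kj; rewrite !mxE ltnNge kj.
- rewrite /inner XTE TE (tr_svd_filterM svdX); apply: big1 => j _; rewrite !mxE.
  by case: ltnP; rewrite ?subrr ?mul0r ?mulr0 ?mul0r.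
rewrite mat_normE /frobenius /inner XTE (tr_svd_filterM svdX) (@tail_sumE _ _ kappa X _ _ svdX).
have s0 j : 0 <= s 0 j by case: svdX.
rewrite -[leRHS]ger0_norm ?sumr_ge0 // -sqrtr_sqr ler_wsqrtr //.
apply: le_trans (sum_sqr_le _) => //; rewrite [leRHS]big_mkcond.
apply: ler_sum => j _; rewrite !mxE ltnNge.
by case: leqP => _; rewrite ?subrr ?mul0r ?subr0 ?mul1r.
Qed.

(** If [T] leaves the ball, it is shrunk radially by [a = gamma / N T]. The loss [(1 - a) |T|] is at
    most [(N T - gamma) / cl], hence at most [N (T - X) / cl] and [(cu / cl) |X - T|]; Pythagoras
    combines it with [X - T]. *)
Lemma norm_ball_retract (N : mat R (RealMx n1 n2) -> R) (gamma cl cu : R) X T :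
  is_norm N -> 0 < gamma -> 0 < cl -> 0 < cu ->
  (forall Y, cl * `|Y| <= N Y <= cu * `|Y|) ->
  N X <= gamma -> inner (X - T) T = 0 ->
  exists a : R, N (a *: T) <= gamma /\
    `|X - a *: T| <= Num.sqrt (1 + cu ^+ 2 / cl ^+ 2) * `|X - T|.
Proof.
move=> nN g0 cl0 cu0 Nb NX orth.
have [NT|NT] := leP (N T) gamma.
  exists 1; rewrite scale1r; split=> //; apply: ler_peMl => //.
  rewrite -[leLHS]sqrtr1 ler_wsqrtr // lerDl divr_ge0 ?sqr_ge0 //.
have NT0 : 0 < N T := lt_trans g0 NT.
have [ND NZ _] := nN; pose a := gamma / N T.
have a0 : 0 <= a by rewrite divr_ge0 ?ltW.
have a1 : a <= 1 by rewrite ler_pdivrMr // mul1r ltW.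
exists a; split; first by rewrite NZ ger0_norm // divfK ?gt_eqF.
have pyth : `|X - a *: T| ^+ 2 = `|X - T| ^+ 2 + ((1 - a) * `|T|) ^+ 2.
  have -> : X - a *: T = (X - T) + (1 - a) *: T by rewrite scalerBl scale1r addrA subrK.
  have o' : inner (X - T) ((1 - a) *: T) = 0 by rewrite innerZr orth mulr0.
  have nE : `|(1 - a) *: T| = (1 - a) * `|T| by rewrite normrZ ger0_norm ?subr_ge0.
  by rewrite -nE; exact: mat_pythagoras.
have bound : (1 - a) * `|T| <= cu / cl * `|X - T|.
  have NXT : N T - gamma <= cu * `|X - T|.
    have sub : N T <= N (T - X) + N X by have := ND (T - X) X; rewrite subrK.
    rewrite lerBlDr (distrC X T); apply: le_trans sub _; apply: lerD NX.
    by case/andP: (Nb (T - X)).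
  have Tle : `|T| <= N T / cl.
    by rewrite ler_pdivlMr // mulrC; case/andP: (Nb T).
  apply: (@le_trans _ _ ((1 - a) * (N T / cl))).
    by rewrite ler_wpM2l // subr_ge0.
  rewrite mulrA mulrBl mul1r /a divfK ?gt_eqF // mulrAC.
  by rewrite ler_wpM2r // invr_ge0 ltW.
have y0 : 0 <= (1 - a) * `|T| by apply: mulr_ge0; rewrite ?subr_ge0 ?normr_ge0.
have q0 : 0 <= cu / cl by apply: divr_ge0; exact: ltW.
rewrite -expr_div_n; exact: (hypotenuse_le (normr_ge0 _) y0 q0 pyth bound).
Qed.

End RealTruncation.

(** * Hermitian positive semidefinite matrices *)

Section HermitianTruncation.
Variables (R : realType) (n : nat).
Implicit Types (X : mat R (HermMx n)) (W : 'M[R[i]]_n) (l : 'rV[R]_n).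

Lemma hmx_exists (M : 'M[R[i]]_n) : M^t* = M ->
  exists X : mat R (HermMx n), hmx X = M.
Proof.
move=> hM; have hM' : M \in @is_hermitian R n by rewrite is_hermitianE hM.
by exists (Sub M hM' : Defs.hermitian R n).
Qed.

Lemma rdiag_conj_herm W l : (W^t* *m rdiag l *m W)^t* = W^t* *m rdiag l *m W.
Proof. by rewrite !adjM trmxCK rdiag_adj mulmxA. Qed.

Lemma psd_gram (m : nat) (V : 'M[R[i]]_(m, n)) : psd (V^t* *m V).
Proof.
move=> v; rewrite mulmxA -adjM -mulmxA gram_diagE ler0c.
by apply: sumr_ge0 => i _; rewrite addr_ge0 ?sqr_ge0.
Qed.

Lemma rdiag_conj_gram W l : (forall j, 0 <= l 0 j) ->
  W^t* *m rdiag l *m W =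
  (rdiag (\row_j Num.sqrt (l 0 j)) *m W)^t* *m (rdiag (\row_j Num.sqrt (l 0 j)) *m W).
Proof.
move=> l0; rewrite gramM rdiag_adj rdiagM.
apply: (congr1 (fun d => W^t* *m rdiag d *m W)).
by apply/rowP => j; rewrite !mxE -expr2 sqr_sqrtr.
Qed.

(** The eigenvalues are values of the quadratic form at unit eigenvectors, hence nonnegative; so
    they are the singular values, and one sorted decomposition serves as both. *)
Lemma psd_matrix_svd (A : 'M[R[i]]_n) : A^t* = A -> psd A ->
  exists W l, A = W^t* *m rdiag l *m W /\ right_svd A W l.
Proof.
move=> hA pA; have nA : A \is normalmx.
  by apply: hermitian_normalmx; apply/is_hermitianmxP; rewrite expr0 scale1r hA.
pose V := spectralmx A; pose d := spectral_diag A.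
have Vu : V \is unitarymx by exact: spectral_unitarymx.
have AA : A = V^t* *m diag_mx d *m V 
  by rewrite -(invmx_unitary Vu); exact/orthomx_spectralP.
have d0 j : 0 <= d 0 j.
  have -> : d 0 j = (V *m A *m V^t*) j j.
    rewrite AA !mulmxA (unitarymxP Vu) mul1mx -mulmxA (unitarymxP Vu) mulmx1.
    by rewrite mxE eqxx.
  have := pA (col j (V^t*)).
  have -> : (col j (V^t*))^t* = row j V.
    by rewrite tr_col map_row -[in RHS](trmxCK V).
  suff -> : (V *m A *m V^t*) j j = (row j V *m A *m col j (V^t*)) 0 0 by [].
  rewrite -row_mul [LHS]mxE [RHS]mxE; apply: eq_bigr => k _.
  by congr (_ * _); rewrite [RHS]mxE.
have dE j : d 0 j = (complex.Re (d 0 j))%:C by rewrite RRe_real // ger0_real.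
have [p pP] := ord_sort_perm (fun j => complex.Re (d 0 j)).
pose W := row_perm p V; pose l := \row_j complex.Re (d 0 (p j)).
have Wu : W \is unitarymx by exact: row_perm_unitary.
have AW : A = W^t* *m rdiag l *m W.
  rewrite AA -(diag_mx_row_perm p) row_perm_adj.
  apply: (congr1 (fun d => col_perm p (V^t*) *m diag_mx d *m row_perm p V)).
  by apply/rowP => j; rewrite !mxE [LHS]dE.
exists W, l; split; first exact: AW.
split; first exact: Wu.
- rewrite hA {1 2}AW !mulmxA (mulmxtVK _ Wu) -(mulmxA (W^t*)) rdiagM.
  apply: (congr1 (fun d => W^t* *m rdiag d *m W)).
  by apply/rowP => j; rewrite !mxE.
- by move=> j; rewrite mxE -ler0c -dE.
- by move=> i j ij; rewrite !mxE pP.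
Qed.

Lemma psd_spectral X : psd (hmx X) ->
  exists W l, hmx X = W^t* *m rdiag l *m W /\ right_svd (cmx X) W l.
Proof.
apply: psd_matrix_svd; apply/esym/eqP; rewrite -is_hermitianE.
exact: (valP (X : Defs.hermitian R n)).
Qed.

Lemma herm_norm_rdiag X W l : W \is unitarymx ->
  hmx X = W^t* *m rdiag l *m W -> `|X| = Num.sqrt (\sum_j l 0 j ^+ 2).
Proof.
move=> Wu XW; rewrite mat_normE /frobenius /inner -[cmx X]/(hmx X) XW.
rewrite rdiag_conj_herm !mulmxA (mulmxtVK _ Wu) -(mulmxA (W^t*)) rdiagM.
rewrite mxtrace_mulC mulmxA (unitarymxP Wu) mul1mx tr_rdiag /=.
by congr Num.sqrt; apply: eq_bigr => j _; rewrite mxE expr2.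
Qed.

Lemma tr_rdiag_conj W l : W \is unitarymx ->
  \tr (W^t* *m rdiag l *m W) = (\sum_j l 0 j)%:C.
Proof.
by move=> Wu; rewrite mxtrace_mulC mulmxA (unitarymxP Wu) mul1mx tr_rdiag.
Qed.

Lemma rank_rdiag_conj_le W l (k : nat) : (forall j : 'I_n, (k <= j)%N -> l 0 j = 0) ->
  (\rank (W^t* *m rdiag l *m W) <= k)%N.
Proof.
move=> lk; apply: leq_trans (mxrankM_maxl _ _) _; apply: leq_trans (mxrankM_maxr _ _) _.
by apply: rank_diag_mx_le => j kj; rewrite mxE lk.
Qed.

Lemma hmxB X Y : hmx (X - Y) = hmx X - hmx Y.
Proof. exact: (@cmxB R (HermMx n) X Y). Qed.

(* The mass [tau] of the discarded eigenvalues is given back to the largest one. *)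
Lemma density_retract (kappa : nat) X : (0 < kappa)%N ->
  psd (hmx X) -> \tr (hmx X) = 1 ->
  exists2 Z : mat R (HermMx n),
    [/\ psd (hmx Z), \tr (hmx Z) = 1 & (\rank (cmx Z) <= kappa)%N] &
    `|X - Z| <= Num.sqrt 2 * tail_sum kappa X.
Proof.
move=> k0 /psd_spectral[W [l [XW svdX]]] trX.
have [Wu _ l0 _] := svdX; set tau := tail_sum kappa X.
have tau0 : 0 <= tau by exact: tail_sum_ge0.
have tauE : tau = \sum_(j < n | (kappa <= j)%N) l 0 j.
  exact: (@tail_sumE _ _ kappa X _ _ svdX).
have suml : \sum_j l 0 j = 1.
  by move: trX; rewrite XW tr_rdiag_conj // => /complexI.
have n0 : (0 < n)%N.
  rewrite lt0n; apply/eqP => n0; move: suml.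
  rewrite big1 => [/eqP|j _]; first by rewrite eq_sym oner_eq0.
  have : (0 < n)%N := leq_ltn_trans (leq0n j) (ltn_ord j).
  by rewrite {1}n0.
pose o : 'I_n := Ordinal n0.
(* The spectrum of [X - Z] in the eigenbasis of [X]. As [kappa] is positive, the index [o] that
   receives [tau] is not among the discarded ones. *)
pose h : 'rV[R]_n := \row_j (if j == o then - tau else if (kappa <= j)%N then l 0 j else 0).
have ok : (kappa <= o)%N = false by rewrite leqNgt k0.
have oP (j : 'I_n) : (kappa <= j)%N = (kappa <= j)%N && (j != o).
  by case: eqP => [->|_]; rewrite ?ok ?andbF ?andbT.
have [Z ZE] := hmx_exists (rdiag_conj_herm W (l - h)).
have sumh (F : R -> R) : F 0 = 0 ->
    \sum_j F (h 0 j) = F (- tau) + \sum_(j < n | (kappa <= j)%N) F (l 0 j).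
  move=> F0; rewrite (bigD1 o) //= mxE eqxx; congr (_ + _).
  rewrite [RHS](eq_bigl _ _ oP) [RHS]big_mkcondl /=; apply: eq_bigr => j jo.
  by rewrite mxE (negbTE jo); case: ifP.
exists Z; first split.
- rewrite ZE rdiag_conj_gram; first exact: psd_gram.
  move=> j; rewrite !mxE; case: eqP => _; first by rewrite opprK addr_ge0.
  by case: ifP; rewrite ?subrr ?subr0.
- rewrite ZE tr_rdiag_conj //.
  under eq_bigr do rewrite [_ 0 _]mxE [(- h) 0 _]mxE.
  by rewrite big_split /= sumrN suml (sumh id) // -tauE addNr subr0.
- rewrite -[cmx Z]/(hmx Z) ZE; apply: rank_rdiag_conj_le => j kj.
  by rewrite !mxE kj; case: eqP kj => [->|_ _]; rewrite ?ok ?subrr.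
have XZ : hmx (X - Z) = W^t* *m rdiag h *m W.
  rewrite hmxB XW ZE -mulmxBl -mulmxBr -rdiagB; apply: (congr1 (fun d => W^t* *m rdiag d *m W)).
  by rewrite opprB addrCA subrr addr0.
rewrite (herm_norm_rdiag Wu XZ) -[leRHS]ger0_norm ?mulr_ge0 ?sqrtr_ge0 //.
rewrite -sqrtr_sqr ler_wsqrtr // exprMn sqr_sqrtr // (sumh (fun x => x ^+ 2)); last first.
  by rewrite expr0n.
(* The squared norm is [tau^2] plus the squares of the discarded eigenvalues, which add up to at
   most [tau^2]: hence the constant [sqrt 2]. *)
rewrite sqrrN mulrDl mul1r lerD2l tauE.
by apply: sum_sqr_le => j _.
Qed.

End HermitianTruncation.

(** * Correlation matrices *)

Section CorrelationTruncation.
Variable R : realType.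

Lemma sqr_normcE (z : R[i]) : normc z ^+ 2 = complex.Re z ^+ 2 + complex.Im z ^+ 2.
Proof. by case: z => a b; rewrite /normc sqr_sqrtr // addr_ge0 ?sqr_ge0. Qed.

Lemma normc_ge0 (z : R[i]) : 0 <= normc z.
Proof. by case: z => a b; exact: sqrtr_ge0. Qed.

Lemma normc_conj (z : R[i]) : normc (Num.conj z) = normc z.
Proof. by case: z => a b; rewrite /normc /= sqrrN. Qed.

Lemma normc_real (x : R) : normc x%:C = `|x|.
Proof. by rewrite /normc /= expr0n addr0 sqrtr_sqr. Qed.

Lemma le_normc_sum (I : finType) (F : I -> R[i]) :
  normc (\sum_i F i) <= \sum_i normc (F i).
Proof.
elim/big_ind2: _ => [|x z y w xz yw|i _]; [by rewrite normc0| |by []].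
exact: le_trans (le_normcD z w) (lerD xz yw).
Qed.

Lemma mulmx_adj_diagE (n m : nat) (V : 'M[R[i]]_(n, m)) i :
  (V *m V^t*) i i = (\sum_k normc (V i k) ^+ 2)%:C.
Proof.
rewrite -{1}(trmxCK V) gram_diagE; congr _%:C; apply: eq_bigr => k _.
by rewrite -sqr_normcE !mxE normc_conj.
Qed.

Lemma normc_gram_le1 (n m : nat) (U : 'M[R[i]]_(n, m)) i j :
  (forall i, \sum_k normc (U i k) ^+ 2 = 1) -> normc ((U *m U^t*) i j) <= 1.
Proof.
move=> U1; rewrite mxE; apply: le_trans (le_normc_sum _) _.
apply: (@le_trans _ _ (\sum_k (normc (U i k) ^+ 2 + normc (U j k) ^+ 2) / 2)).
  apply: ler_sum => k _; rewrite normcM !mxE normc_conj ler_pdivlMr // -subr_ge0.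
  set a := normc _; set b := normc _.
  by rewrite (_ : _ - _ = (a - b) ^+ 2) ?sqr_ge0 //; ring.
by rewrite -mulr_suml big_split /= !U1 divff.
Qed.

(** A zero row is replaced by the first basis vector, so that every row of [U] has norm 1; as [k] is
    positive, that vector is still supported in the first [k] columns. *)
Lemma normalize_rows (n : nat) (V : 'M[R[i]]_n) (k : nat) : (0 < k)%N ->
  (forall (i j : 'I_n), (k <= j)%N -> V i j = 0) ->
  exists U : 'M[R[i]]_n, [/\ forall i, \sum_j normc (U i j) ^+ 2 = 1,
    forall i j, V i j = (Num.sqrt (\sum_j normc (V i j) ^+ 2))%:C * U i j &
    forall (i j : 'I_n), (k <= j)%N -> U i j = 0].
Proof.
move=> k0 Vk; pose d i := \sum_j normc (V i j) ^+ 2.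
have d0 i : 0 <= d i by apply: sumr_ge0 => j _; rewrite sqr_ge0.
exists (\matrix_(i, j) if d i == 0 then ((j == 0 :> nat)%N)%:R
  else V i j * ((Num.sqrt (d i))^-1)%:C); split => [i|i j|i j kj].
- have [di|di] := eqVneq (d i) 0.
    have n0 : (0 < n)%N := leq_ltn_trans (leq0n i) (ltn_ord i).
    rewrite (bigD1 (Ordinal n0)) //= big1 => [|j j0]; rewrite mxE di eqxx.
      by rewrite eqxx addr0 (_ : 1%:R = 1%:C) // normc_real normr1 expr1n.
    by rewrite (negbTE (j0 : j != 0%N :> nat)) normc0 expr0n.
  under eq_bigr => j _.
    rewrite mxE (negbTE di) normcM normc_real exprMn ger0_norm ?invr_ge0 ?sqrtr_ge0 // exprVn sqr_sqrtr //.
    over.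
  by rewrite -mulr_suml mulfV.
- rewrite mxE -/(d i); have [di|di] := eqVneq (d i) 0; last first.
    rewrite mulrCA -rmorphM mulfV ?rmorph1 ?mulr1 //.
    by rewrite sqrtr_eq0 -ltNge lt_neqAle eq_sym di d0.
  rewrite di sqrtr0 mul0r; apply: eq0_normc.
  move: di => /eqP; rewrite psumr_eq0 => [/allP/(_ j)|l _]; last exact: sqr_ge0.
  by rewrite mem_index_enum sqrf_eq0 => /(_ isT)/eqP.
- rewrite mxE Vk // mul0r; case: ifP => // _.
  by rewrite (_ : (j == 0%N :> nat) = false) // gtn_eqF // (leq_trans k0).
Qed.

(** This amounts to [r^2 + t^2 - r t <= 1], whose left-hand side is at most the larger of [r^2] and
    [t^2]. *)
Lemma one_sub_mul_le (r t : R) : 0 <= r -> r <= 1 -> 0 <= t -> t <= 1 ->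
  `|r * t - 1| <= (1 - r ^+ 2) + (1 - t ^+ 2).
Proof.
move=> r0 r1 t0 t1; have rt1 : r * t <= 1 by rewrite mulr_ile1.
rewrite ler0_norm ?subr_le0 // opprB; nra.
Qed.

(** Let [T = V V^*] be the truncation, with diagonal [d], and [Z = U U^*] with [U] the normalized
    rows of [V]. Then [|X - T| <= tau], and the entry [(i, j)] of [T - Z] is [sqrt(d_i d_j) - 1]
    times a number of modulus at most 1, so at most [(1 - d_i) + (1 - d_j)] in modulus. *)
Lemma correlation_retract (n kappa : nat) (X : mat R (HermMx n)) : (0 < kappa)%N ->
  psd (hmx X) -> (forall i, hmx X i i = 1) ->
  exists2 Z : mat R (HermMx n),
    [/\ psd (hmx Z), forall i, hmx Z i i = 1 & (\rank (cmx Z) <= kappa)%N] &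
    `|X - Z| <= (1 + 2 * n%:R) * tail_sum kappa X.
Proof.
move=> k0 /psd_spectral[W [l [XW svdX]]] X1.
have [Wu _ l0 _] := svdX; set tau := tail_sum kappa X.
have tauE : tau = \sum_(j < n | (kappa <= j)%N) l 0 j.
  exact: (@tail_sumE _ _ kappa X _ _ svdX).
pose h : 'rV[R]_n := \row_j (if (kappa <= j)%N then l 0 j else 0).
have h0 j : 0 <= h 0 j by rewrite mxE; case: ifP.
have sumh : \sum_j h 0 j = tau.
  by rewrite tauE [RHS]big_mkcond; apply: eq_bigr => j _; rewrite mxE.
pose q : 'rV[R]_n := \row_j (if (kappa <= j)%N then 0 else Num.sqrt (l 0 j)).
pose V := W^t* *m rdiag q.
have VV : V *m V^t* = W^t* *m rdiag (l - h) *m W.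
  rewrite /V adjM trmxCK rdiag_adj !mulmxA -(mulmxA (W^t*)) rdiagM.
  apply: (congr1 (fun d => W^t* *m rdiag d *m W)); apply/rowP => j; rewrite !mxE.
  by case: ifP => _; rewrite ?mul0r ?subrr // subr0 -expr2 sqr_sqrtr.
have XT : hmx X - V *m V^t* = W^t* *m rdiag h *m W.
  rewrite VV XW -mulmxBl -mulmxBr -rdiagB.
  apply: (congr1 (fun d => W^t* *m rdiag d *m W)).
  by rewrite opprB addrCA subrr addr0.
have Vk (i j : 'I_n) : (kappa <= j)%N -> V i j = 0.
  by move=> kj; rewrite /V mul_mx_diag !mxE kj mulr0.
have [U [U1 VU Uk]] := normalize_rows k0 Vk.
set d := fun i => \sum_j normc (V i j) ^+ 2 in VU.
have d0 i : 0 <= d i by apply: sumr_ge0 => j _; rewrite sqr_ge0.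
have dE i : (hmx X - V *m V^t*) i i = (1 - d i)%:C.
  by rewrite mxE [X in _ + X]mxE X1 mulmx_adj_diagE rmorphB.
(* The numbers [1 - d i] form the diagonal of [X - V V^*], which is positive semidefinite with trace
   [tau]. *)
have d1 i : 0 <= 1 - d i.
  rewrite -ler0c -dE XT (rdiag_conj_gram _ h0) gram_diagE ler0c.
  by apply: sumr_ge0 => j _; rewrite addr_ge0 ?sqr_ge0.
have sumd : \sum_i (1 - d i) = tau.
  rewrite -sumh; apply: complexI; rewrite -(tr_rdiag_conj _ Wu) -XT rmorph_sum.
  by apply: eq_bigr => i _; rewrite dE.
pose r i := Num.sqrt (d i).
have VUr i j : V i j = (r i)%:C * U i j := VU i j.
have TE i j : (V *m V^t*) i j = (r i * r j)%:C * (U *m U^t*) i j.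
  rewrite [LHS]mxE [X in _ = _ * X]mxE mulr_sumr; apply: eq_bigr => k _.
  rewrite [(V^t*) k j]mxE [V^T k j]mxE [(U^t*) k j]mxE [U^T k j]mxE.
  rewrite (VUr i k) (VUr j k) !rmorphM /= mulrACA; congr (_ * _ * _).
  exact: conjc_real.
have [T TW] := hmx_exists (rdiag_conj_herm W (l - h)).
have [Z ZE] : exists Z : mat R (HermMx n), hmx Z = U *m U^t*.
  by apply: hmx_exists; rewrite adjM trmxCK.
exists Z; first split.
- by rewrite ZE -{1}(trmxCK U); exact: psd_gram.
- by move=> i; rewrite ZE mulmx_adj_diagE U1.
- rewrite -[cmx Z]/(hmx Z) ZE; apply: leq_trans (mxrankM_maxl _ _) _.
  have -> : U = U *m diag_mx (\row_j (j < kappa)%N%:R).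
    apply/matrixP => i j; rewrite mul_mx_diag !mxE.
    by case: ltnP => [_|/Uk->]; rewrite ?mulr1 ?mul0r.
  apply: leq_trans (mxrankM_maxr _ _) _.
  by apply: rank_diag_mx_le => j kj; rewrite mxE ltnNge kj.
apply: le_trans (ler_distD T X Z) _; rewrite mulrDl mul1r; apply: lerD.
  have XTh : hmx (X - T) = W^t* *m rdiag h *m W by rewrite hmxB TW -VV.
  rewrite (herm_norm_rdiag Wu XTh) -sumh -[leRHS]ger0_norm ?sumr_ge0 //.
  rewrite -sqrtr_sqr ler_wsqrtr //.
  by apply: (sum_sqr_le (P := xpredT)).
rewrite mat_normE /frobenius innerE pair_bigA /=.
pose a (p : 'I_n * 'I_n) := normc (hmx (T - Z) p.2 p.1).
have -> : \sum_p (complex.Re (cmx (T - Z) p.2 p.1) * complex.Re (cmx (T - Z) p.2 p.1) +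
    complex.Im (cmx (T - Z) p.2 p.1) * complex.Im (cmx (T - Z) p.2 p.1)) =
    \sum_p a p ^+ 2.
  by apply: eq_bigr => p _; rewrite sqr_normcE -!expr2.
have a0 p : 0 <= a p by exact: normc_ge0.
(* The Frobenius norm is at most the sum of the moduli of the entries. *)
apply: (@le_trans _ _ (\sum_p a p)).
  rewrite -[leRHS]ger0_norm ?sumr_ge0 // -sqrtr_sqr ler_wsqrtr //.
  by apply: (sum_sqr_le (P := xpredT)).
apply: (@le_trans _ _ (\sum_(p : 'I_n * 'I_n) ((1 - d p.2) + (1 - d p.1)))).
  apply: ler_sum => -[j i] _; rewrite /a /= hmxB TW -VV ZE mxE [X in _ + X]mxE TE.
  have -> (x : R) (z : R[i]) : x%:C * z - z = (x - 1)%:C * z.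
    by rewrite rmorphB rmorph1 mulrBl mul1r.
  rewrite normcM normc_real -[leRHS]mulr1 ler_pM ?normc_ge0 ?normc_gram_le1 //.
  have r1 k : r k <= 1 by rewrite -sqrtr1 ler_wsqrtr // -subr_ge0.
  have rE k : r k ^+ 2 = d k by rewrite sqr_sqrtr.
  by rewrite -!rE one_sub_mul_le ?sqrtr_ge0.
(* Each [1 - d i] is counted [n] times as a row index and [n] times as a column index, which gives
   [2 n tau]. *)
rewrite -(pair_bigA _ (fun j i => (1 - d i) + (1 - d j))) /=.
under eq_bigr => j _ do rewrite big_split /= sumd sumr_const card_ord.
rewrite big_split /= sumr_const card_ord sumrMnl sumd.
by rewrite -mulr2n -[tau *+ n]mulr_natl -[_ *+ 2]mulr_natl mulrA.
Qed.

End CorrelationTruncation.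

(** * The error bound and its explicit constants *)

Theorem theorem2p4 (R : realType) :
  (forall (s : mxspace) (Omega : set (mat R s)) (kappa : nat)
      (f : mat R s -> R) (gradf : mat R s -> mat R s),
    assumptions Omega kappa f gradf ->
    exists c : R, 0 < c /\ error_bound Omega kappa f gradf c) /\
  (forall (n1 n2 : nat) (N : mat R (RealMx n1 n2) -> R) (gamma cl cu : R)
      (kappa : nat) (f : mat R (RealMx n1 n2) -> R)
      (gradf : mat R (RealMx n1 n2) -> mat R (RealMx n1 n2)),
    is_norm N -> 0 < gamma -> 0 < cl -> 0 < cu ->
    (forall X, cl * `|X| <= N X <= cu * `|X|) ->
    let Omega := [set X | N X <= gamma] in
    assumptions Omega kappa f gradf ->
    error_bound Omega kappa f gradf (Num.sqrt (1 + cu ^+ 2 / cl ^+ 2))) /\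
  (forall (n kappa : nat) (f : mat R (HermMx n) -> R)
      (gradf : mat R (HermMx n) -> mat R (HermMx n)),
    let Omega := [set X | psd (hmx X) /\ \tr (hmx X) = 1] in
    assumptions Omega kappa f gradf ->
    error_bound Omega kappa f gradf (Num.sqrt 2)) /\
  (forall (n kappa : nat) (f : mat R (HermMx n) -> R)
      (gradf : mat R (HermMx n) -> mat R (HermMx n)),
    let Omega := [set X | psd (hmx X) /\ forall i, hmx X i i = 1] in
    assumptions Omega kappa f gradf ->
    error_bound Omega kappa f gradf (1 + 2 * n%:R)).

Proof.
split; [|split; [|split]].
- move=> s Omega kappa f gradf asm; have [c c0 tc] := tail_error_bound asm.
  by exists c; split=> //; exact: (error_bound_of_tail asm (ltW c0) tc).
- move=> n1 n2 N gamma cl cu kappa f gradf nN g0 cl0 cu0 Nb Omega asm.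
  apply: (error_bound_of_tail asm (sqrtr_ge0 _)) => Y NY.
  have [T [rT orth dT]] := real_truncation kappa Y.
  have [a [Na da]] := norm_ball_retract nN g0 cl0 cu0 Nb NY orth.
  exists (a *: T); last exact: le_trans da (ler_wpM2l (sqrtr_ge0 _) dT).
  split; first exact: Na.
  by rewrite cmxZ; apply: leq_trans rT; exact/mxrankS/scalemx_sub.
- move=> n kappa f gradf Omega asm.
  apply: (error_bound_of_tail asm (sqrtr_ge0 _)) => Y [pY trY].
  have [Z [pZ trZ rZ] YZ] := density_retract (kappa_gt0 asm) pY trY.
  by exists Z.
- move=> n kappa f gradf Omega asm.
  apply: (error_bound_of_tail asm) => [|Y [pY dY]].
    by rewrite addr_ge0 ?mulr_ge0 ?ler0n.
  have [Z [pZ dZ rZ] YZ] := correlation_retract (kappa_gt0 asm) pY dY.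
  by exists Z.
Qed.
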